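(* Let $\mathcal H$ be a finite-dimensional complex Hilbert space, let $\Theta\subseteq\mathbb R$ be an open interval, and let $\theta\mapsto\rho(\theta)$, $\theta\in\Theta$, be a differentiable one-parameter family of states on $\mathcal H$. Suppose that $\rho(\theta)$ is strictly positive for every $\theta\in\Theta$, that the quantum score $\rho_{/\!\!/\theta}(\theta)$ has distinct eigenvalues for some value of $\theta$, and that the quantum score is smooth in $\theta$. Suppose that for the outcome of some measurement $M$ on $\mathcal H$ a statistic $t$ exists which is, for all $\theta\in\Theta$, an unbiased estimator of $\theta$ achieving Helstrom's quantum Cramér–Rao bound, i.e. $\mathrm{Var}_\theta(t)=I(\theta)^{-1}$. Then the model is a quantum exponential model of symmetric type, $$\rho(\theta)=c(\theta)\exp\{\tfrac12\theta T\}\,\rho_0\,\exp\{\tfrac12\theta T\},\qquad\theta\in\Theta,$$ for some observable $T$ on $\mathcal H$, where $\rho_0$ is a non-negative self-adjoint operator and $c(\theta)>0$ is a normalising constant; and simple measurement of $T$ is equivalent to the coarsening $M\circ t^{-1}$ of $M$ according to $t$.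
   Context: A state on $\mathcal H$ is a non-negative self-adjoint operator of trace $1$; an observable is a self-adjoint operator on $\mathcal H$. A measurement $M$ with outcome space a measurable space $(\mathcal X,\mathcal A)$ is a countably additive map $A\mapsto M(A)$ from $\mathcal A$ into the non-negative self-adjoint operators on $\mathcal H$ with $M(\mathcal X)=\mathbf 1$. When the state is $\rho(\theta)$, the outcome $x$ of $M$ has law $\mathrm P_\theta(x\in A)=\mathrm{tr}\{\rho(\theta)M(A)\}$. A statistic is a measurable function $t:\mathcal X\to\mathbb R$ of the outcome; its expectation and variance are taken under this law. The coarsening of $M$ according to $t$ is the measurement $(M\circ t^{-1})(B)=M(t^{-1}(B))$ with outcome space $\mathbb R$; it corresponds to recording only the value $t(x)$ of the outcome $x$ of $M$. The simple measurement of an observable $T$ is the measurement whose outcomes are the eigenvalues of $T$ and whose operators are the orthogonal projections onto the corresponding eigenspaces. The quantum score (symmetric logarithmic derivative) $\rho_{/\!\!/\theta}(\theta)$ is the self-adjoint solution (unique if $\rho(\theta)$ is strictly positive) of $\frac{\mathrm d}{\mathrm d\theta}\rho(\theta)=\frac12\{\rho(\theta)\rho_{/\!\!/\theta}(\theta)+\rho_{/\!\!/\theta}(\theta)\rho(\theta)\}$. The quantum information is $I(\theta)=\mathrm{tr}\{\rho(\theta)\rho_{/\!\!/\theta}(\theta)^2\}$. Helstrom's quantum Cramér–Rao bound states that $\mathrm{Var}_\theta(t)\ge I(\theta)^{-1}$ for every unbiased estimator $t$ of $\theta$ based on a measurement.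
   Formalization: The displayed form is false in general (e.g. ρ(θ)=diag(1−θ,θ) on (0,1), t the outcome); the formal theorem replaces θ in the exponentials by a natural parameter γ(θ) with γ'(θ)=I(θ), which gives the display, up to rescaling T, when I is constant. *)

(* Defs.v *)
From HB Require Import structures.
From mathcomp Require Import all_boot all_order all_algebra.
From mathcomp Require Import all_classical all_reals all_analysis.
From mathcomp Require Import sesquilinear spectral complex.

Set Implicit Arguments.
Unset Strict Implicit.
Unset Printing Implicit Defensive.

Import Order.TTheory GRing.Theory Num.Theory.
Import numFieldNormedType.Exports.

Local Open Scope classical_set_scope.
Local Open Scope ring_scope.
Local Open Scope complex_scope.
Local Open Scope sesquilinear_scope.

(* The Hilbert space is C^n with C = R[i]; operators are matrices acting on
   column vectors.  Real-variable calculus on complex matrices is done on the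
   real and imaginary parts of the entries, R[i] being a normed module over
   R[i] but not over R in the library. *)

Definition cvg_mx (R : realType) n (u : nat -> 'M[R[i]]_n) (A : 'M[R[i]]_n) :=
  forall i j, ((fun k => complex.Re (u k i j)) @ \oo --> complex.Re (A i j)) /\
              ((fun k => complex.Im (u k i j)) @ \oo --> complex.Im (A i j)).

Definition derivable_mx (R : realType) n (F : R -> 'M[R[i]]_n) (x : R) :=
  forall i j, derivable (fun s => complex.Re (F s i j)) x 1 /\
              derivable (fun s => complex.Im (F s i j)) x 1.

Definition derive_mx (R : realType) n (F : R -> 'M[R[i]]_n) (x : R) :
    'M[R[i]]_n :=
  \matrix_(i, j) (derive1 (fun s => complex.Re (F s i j)) x +i*
                  derive1 (fun s => complex.Im (F s i j)) x).

Definition smooth_mx_on (R : realType) n (D : set R) (F : R -> 'M[R[i]]_n) :=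
  forall x, D x -> forall (k : nat) i j,
    derivable (derive1n k (fun s => complex.Re (F s i j))) x 1 /\
    derivable (derive1n k (fun s => complex.Im (F s i j))) x 1.

Definition expm (R : realType) n (A : 'M[R[i]]_n) : 'M[R[i]]_n :=
  let s k : 'M[R[i]]_n := \sum_(0 <= m < k) (m`!%:R^-1 : R[i]) *: A ^+ m in
  \matrix_(i, j) (lim ((fun k => complex.Re (s k i j)) @ \oo) +i*
                  lim ((fun k => complex.Im (s k i j)) @ \oo)).

(* In R[i], [0 <= z] (resp. [0 < z]) forces z to be real. *)
Definition psdmx (R : realType) n (A : 'M[R[i]]_n) :=
  A \is hermsymmx /\ forall u : 'cV[R[i]]_n, 0 <= (u^t* *m A *m u) 0 0.

Definition posdefmx (R : realType) n (A : 'M[R[i]]_n) :=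
  A \is hermsymmx /\
  forall u : 'cV[R[i]]_n, u != 0 -> 0 < (u^t* *m A *m u) 0 0.

Record state (R : realType) n := State {
  state_mx :> 'M[R[i]]_n;
  state_psd : psdmx state_mx;
  state_tr : \tr state_mx = 1 }.

Record measurement (R : realType) n d (X : measurableType d) := Measurement {
  meas_op :> set X -> 'M[R[i]]_n;
  meas_psd : forall A, measurable A -> psdmx (meas_op A);
  measT : meas_op [set: X] = 1%:M;
  meas_sigma_additive : forall F : nat -> set X,
    (forall k, measurable (F k)) -> trivIset [set: nat] F ->
    cvg_mx (fun k => \sum_(0 <= m < k) meas_op (F m))
           (meas_op (\bigcup_k F k)) }.

(* The trace below is real and nonnegative on measurable sets.  The library's
   measures must be nonnegative on every set, whence the value 0 elsewhere. *)
Definition law (R : realType) n d (X : measurableType d)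
    (rho : state R n) (M : measurement R n X) (A : set X) : \bar R :=
  if `[< measurable A >] then (complex.Re (\tr (rho *m M A)))%:E else 0%E.

Lemma psd_mxtrace_ge0 (R : realType) n (A B : 'M[R[i]]_n) :
  psdmx A -> psdmx B -> 0 <= \tr (A *m B).
Proof.
move=> [hA pA] [_ pB].
have nA := hermitian_normalmx hA.
have eA := orthomx_spectralP nA.
set P := spectralmx A in eA; set D := spectral_diag A in eA.
have uP : P \is unitarymx := spectral_unitarymx A.
have conjP (C : 'M[R[i]]_n) i :
    (P *m C *m P^t*) i i = ((row i P)^t* ^t* *m C *m (row i P)^t*) 0 0.
  rewrite trmxCK -row_mul mxE [RHS]mxE; apply: eq_bigr => k _.
  by rewrite !mxE.
have DE : diag_mx D = P *m A *m P^t*.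
  have iP : P^t* = invmx P by rewrite invmx_unitary.
  have PU : P \in unitmx by apply: unitarymx_unit.
  by rewrite {1}eA iP -!mulmxA mulmxV // mulmx1 !mulmxA mulmxV // mul1mx.
have D_ge0 i : 0 <= D 0 i.
  have -> : D 0 i = (diag_mx D) i i by rewrite !mxE eqxx.
  by rewrite DE conjP.
have -> : \tr (A *m B) = \tr (diag_mx D *m (P *m B *m P^t*)).
  rewrite {1}eA invmx_unitary // -!mulmxA mxtrace_mulC -!mulmxA.
  by rewrite (mulmxA P B).
rewrite /mxtrace; apply: sumr_ge0 => i _.
rewrite mul_diag_mx mxE; apply: mulr_ge0 => //.
by rewrite conjP.
Qed.

Section law_probability.
Context (R : realType) (n : nat) d (X : measurableType d).
Variables (rho : state R n) (M : measurement R n X).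

Let lawE A : measurable A -> law rho M A = (complex.Re (\tr (rho *m M A)))%:E.
Proof. by move=> mA; rewrite /law; case: asboolP. Qed.

Let tr_ReE (A B : 'M[R[i]]_n) : complex.Re (\tr (A *m B)) =
  \sum_i \sum_j (complex.Re (A i j) * complex.Re (B j i) -
                 complex.Im (A i j) * complex.Im (B j i)).
Proof.
rewrite /mxtrace raddf_sum; apply: eq_bigr => i _.
rewrite mxE raddf_sum; apply: eq_bigr => j _.
by case: (A i j) (B j i) => a b [].
Qed.

Lemma meas0 : M set0 = 0.
Proof.
apply/matrixP => i j; rewrite mxE.
have F0 (k : nat) : measurable (set0 : set X) by [].
have tF : trivIset [set: nat] (fun=> set0 : set X).
  by apply/trivIsetP => *; rewrite set0I.
have [] := meas_sigma_additive (F := fun=> set0) M F0 tF i j.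
rewrite bigcup0 //.
have aux (f : {additive R[i] -> R}) :
    (fun k => f ((\sum_(0 <= m < k) M set0) i j)) @ \oo --> f (M set0 i j) ->
    f (M set0 i j) = 0.
  set x := f _ => cx.
  have uE k : f ((\sum_(0 <= m < k) M set0) i j) = x *+ k.
    by rewrite sumr_const_nat subn0 mulmxnE raddfMn.
  have cx' : (fun k => x *+ k) @ \oo --> x.
    by move: cx; under eq_fun do rewrite uE.
  have cxS : (fun k => x *+ k.+1) @ \oo --> x.
    by move: cx'; rewrite -[in X in X -> _](cvg_shiftS (fun k => x *+ k)).
  have : (fun k => x *+ k.+1 - x *+ k) @ \oo --> x - x by exact: cvgB.
  under eq_fun do rewrite mulrS addrK.
  rewrite subrr => cx0.
  exact: (cvg_unique (@Rhausdorff R) (cvg_cst x) cx0).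
move=> /(aux (@complex.Re R)) hr /(aux (@complex.Im R)) hi.
by move: hr hi; case: (M set0 i j) => a b /= -> ->.
Qed.

Let law0 : law rho M set0 = 0%E.
Proof. by rewrite lawE // meas0 mulmx0 raddf0. Qed.

Let law_ge0 A : (0 <= law rho M A)%E.
Proof.
rewrite /law; case: asboolP => // mA; rewrite lee_fin.
have := psd_mxtrace_ge0 (state_psd rho) (meas_psd M mA).
by case: (\tr _) => a b; rewrite lecE /= => /andP[].
Qed.

Let law_sigma_additive : semi_sigma_additive (law rho M).
Proof.
move=> F mF tF mUF; rewrite lawE //.
have -> : (fun k => \sum_(0 <= m < k) law rho M (F m))%E =
    (fun k => (complex.Re (\tr (rho *m \sum_(0 <= m < k) M (F m))))%:E).
  apply/funext => k; rewrite mulmx_sumr (raddf_sum (@mxtrace _ n)).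
  rewrite (raddf_sum (@complex.Re R)) -sumEFin.
  by apply: eq_bigr => m _; rewrite lawE.
apply: cvg_EFin; first exact: nearW.
rewrite tr_ReE.
under eq_fun do rewrite /= tr_ReE.
apply: cvg_big => [|i _]; first exact: add_continuous.
apply: cvg_big => [|j _]; first exact: add_continuous.
have [cr ci] := meas_sigma_additive M mF tF j i.
by apply: cvgB; apply: cvgMl_tmp.
Qed.

HB.instance Definition _ := isMeasure.Build _ _ _ (law rho M)
  law0 law_ge0 law_sigma_additive.

Let lawT : law rho M [set: X] = 1%E.
Proof. by rewrite lawE // measT mulmx1 state_tr. Qed.

HB.instance Definition _ := Measure_isProbability.Build _ _ _ (law rho M) lawT.

End law_probability.

Section coarsening.
Context (R : realType) (n : nat) d (X : measurableType d) d' (Y : measurableType d').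
Variables (M : measurement R n X) (t : {mfun X >-> Y}).

Let op (B : set Y) := M (t @^-1` B).

Let mt (B : set Y) : measurable B -> measurable (t @^-1` B).
Proof. by move=> mB; apply: measurable_funPTI. Qed.

Let op_psd B : measurable B -> psdmx (op B).
Proof. by move=> mB; apply: meas_psd; exact: mt. Qed.

Let opT : op [set: Y] = 1%:M.
Proof. by rewrite /op preimage_setT measT. Qed.

Let op_sigma_additive (F : nat -> set Y) :
  (forall k, measurable (F k)) -> trivIset [set: nat] F ->
  cvg_mx (fun k => \sum_(0 <= m < k) op (F m)) (op (\bigcup_k F k)).
Proof.
move=> mF tF; rewrite /op preimage_bigcup.
apply: (meas_sigma_additive M (F := fun k => t @^-1` F k)).
  by move=> k; exact: mt.
by move=> i j Di Dj [x [Fi Fj]]; apply: (tF i j Di Dj); exists (t x).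
Qed.

Definition coarsening : measurement R n Y :=
  Measurement op_psd opT op_sigma_additive.

End coarsening.

(* [proj_ortho (eigenspace T a)] is the orthogonal projection onto the
   a-eigenspace: [eigenspace] is about row vectors, but for Hermitian T the row
   and column spectral projections are the same matrix.  The sum ranges over
   the finitely many distinct eigenvalues of T lying in B; the eigenvalues of a
   Hermitian T are all real. *)
Definition simple_measurement (R : realType) n (T : 'M[R[i]]_n) (B : set R) :
    'M[R[i]]_n :=
  \sum_(a \in [set a : R | B a /\ eigenvalue T a%:C])
     proj_ortho (eigenspace T a%:C).

Definition distinct_eigenvalues (R : realType) n (A : 'M[R[i]]_n) :=
  exists s : seq R[i], char_poly A = \prod_(a <- s) ('X - a%:P) /\ uniq s.

Definition is_qscore (R : realType) n (rho : R -> state R n) (theta : R)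
    (L : 'M[R[i]]_n) :=
  L \is hermsymmx /\
  derive_mx rho theta =
    (2^-1 : R[i]) *: (rho theta *m L + L *m rho theta).

(* For differentiable families of strictly positive states the score exists
   and is unique, so that the default value 0 is never used. *)
Definition qscore (R : realType) n (rho : R -> state R n) (theta : R) :
    'M[R[i]]_n :=
  xget 0 [set L | is_qscore rho theta L].

Definition qinfo (R : realType) n (rho : R -> state R n) (theta : R) : R :=
  complex.Re (\tr (rho theta *m (qscore rho theta *m qscore rho theta))).

(* Main.v *)
(* Let T and S be the first and second moment operators of t: the matrices with
   E_sigma[t] = tr(sigma T) and E_sigma[t^2] = tr(sigma S) for all states sigma.
   They are limits of the moments of simple functions, and
   sum_y (y u - w)^* M(y) (y u - w) >= 0 with w = T u gives S >= T^2.
   Differentiating E_theta[t] = theta shows that the score L has inner product 1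
   with T - theta for the form Re tr(rho A B), so Cauchy-Schwarz and S >= T^2
   reprove Helstrom's bound; equality in it forces S = T^2 and
   L = I(theta) (T - theta), rho being strictly positive.  If T v = a v, then
   S = T^2 makes the law of t in the state v have variance 0 around a, so
   M o t^-1 is the spectral measure of T.  In an eigenbasis of T the score
   equation reads rho_kl' = I (((l_k + l_l) / 2) - theta) rho_kl, a scalar linear
   equation for each entry.  A primitive of I needs no integration: it is
   (ln rho_ii - ln rho_jj) / (l_i - l_j) for any two distinct eigenvalues. *)
Require Import Defs.
From HB Require Import structures.
From mathcomp Require Import all_boot all_order all_algebra.
From mathcomp Require Import all_classical all_reals all_analysis.
From mathcomp Require Import sesquilinear spectral complex.
From mathcomp Require Import measurable_realfun ring lra.

Set Implicit Arguments.
Unset Strict Implicit.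
Unset Printing Implicit Defensive.

Import Order.TTheory GRing.Theory Num.Theory.
Import numFieldNormedType.Exports HBNNSimple.

Local Open Scope classical_set_scope.
Local Open Scope ring_scope.
Local Open Scope complex_scope.

(** * Hermitian matrices, positivity and the real trace form *)

Section hermitian_matrices.
Local Open Scope sesquilinear_scope.
Context (R : realType).
Implicit Types n : nat.

(* The ascribed types keep all products in one and the same ring structure on
   R[i], which the rewriting tactics need. *)
Definition adjmx m n (A : 'M[R[i]]_(m, n)) : 'M[R[i]]_(n, m) := A^t*.
Definition toC (x : R) : R[i] := x%:C.
Definition rdiag n (d : 'I_n -> R) : 'M[R[i]]_n := diag_mx (\row_i toC (d i)).
Definition Retr n (A : 'M[R[i]]_n) : R := complex.Re (\tr A).

Lemma toCD x y : toC (x + y) = toC x + toC y. Proof. exact: rmorphD. Qed.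
Lemma toCB x y : toC (x - y) = toC x - toC y. Proof. exact: rmorphB. Qed.
Lemma toCM x y : toC (x * y) = toC x * toC y. Proof. exact: rmorphM. Qed.
Lemma toC_sum (I : Type) (r : seq I) (F : I -> R) :
  toC (\sum_(i <- r) F i) = \sum_(i <- r) toC (F i).
Proof. exact: rmorph_sum. Qed.
Lemma toC_ge0 x : (0 <= toC x) = (0 <= x). Proof. exact: ler0c. Qed.

Lemma Re_conjC (z : R[i]) : complex.Re (Num.conj z) = complex.Re z.
Proof. by case: z. Qed.

Lemma conjC_toC x : Num.conj (toC x) = toC x.
Proof. by apply/eqP; rewrite eq_complex /= oppr0 !eqxx. Qed.

Lemma adjmxE m n (A : 'M[R[i]]_(m, n)) i j : adjmx A i j = Num.conj (A j i).
Proof. by rewrite !mxE. Qed.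

Lemma adjmxK m n (A : 'M[R[i]]_(m, n)) : adjmx (adjmx A) = A.
Proof. exact: trmxCK. Qed.

Lemma adjmxM m n p (A : 'M[R[i]]_(m, n)) (B : 'M[R[i]]_(n, p)) :
  adjmx (A *m B) = adjmx B *m adjmx A.
Proof. by rewrite /adjmx trmx_mul map_mxM. Qed.

Lemma adjmxD m n (A B : 'M[R[i]]_(m, n)) : adjmx (A + B) = adjmx A + adjmx B.
Proof. by rewrite /adjmx linearD /= map_mxD. Qed.

Lemma adjmxN m n (A : 'M[R[i]]_(m, n)) : adjmx (- A) = - adjmx A.
Proof. by rewrite /adjmx linearN /= map_mxN. Qed.

Lemma adjmxZ m n x (A : 'M[R[i]]_(m, n)) : adjmx (toC x *: A) = toC x *: adjmx A.
Proof. by apply/matrixP => i j; rewrite !(mxE, adjmxE) rmorphM /= conjC_toC. Qed.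

Lemma adjmx1 n : adjmx 1%:M = 1%:M :> 'M[R[i]]_n.
Proof. by rewrite /adjmx trmx1 map_mx1. Qed.

Lemma hermsymP n (A : 'M[R[i]]_n) : reflect (adjmx A = A) (A \is hermsymmx).
Proof.
apply: (iffP (is_hermitianmxP _ _ _)); rewrite expr0 scale1r.
  by move=> {2}->.
by move=> {1}<-.
Qed.

Lemma psdmxP n (A : 'M[R[i]]_n) :
  psdmx A <-> adjmx A = A /\
    forall u : 'cV[R[i]]_n, 0 <= (adjmx u *m A *m u) 0 0.
Proof. by split=> -[/hermsymP hA pA]; split=> //; exact/hermsymP. Qed.

Lemma posdefmxP n (A : 'M[R[i]]_n) :
  posdefmx A <-> adjmx A = A /\
    forall u : 'cV[R[i]]_n, u != 0 -> 0 < (adjmx u *m A *m u) 0 0.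
Proof. by split=> -[/hermsymP hA pA]; split=> //; exact/hermsymP. Qed.

Lemma RetrD n (A B : 'M[R[i]]_n) : Retr (A + B) = Retr A + Retr B.
Proof. by rewrite /Retr linearD raddfD. Qed.

Lemma RetrN n (A : 'M[R[i]]_n) : Retr (- A) = - Retr A.
Proof. by rewrite /Retr linearN raddfN. Qed.

Lemma RetrZ n x (A : 'M[R[i]]_n) : Retr (toC x *: A) = x * Retr A.
Proof.
by rewrite /Retr linearZ /=; case: (\tr A) => a b /=; rewrite mul0r subr0.
Qed.

Lemma Retr_sum n (I : Type) (r : seq I) (F : I -> 'M[R[i]]_n) :
  Retr (\sum_(i <- r) F i) = \sum_(i <- r) Retr (F i).
Proof.
rewrite /Retr; elim/big_rec2: _ => [|i x A _ <-]; first by rewrite mxtrace0.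
by rewrite linearD raddfD.
Qed.

Lemma RetrC m n (A : 'M[R[i]]_(m, n)) (B : 'M[R[i]]_(n, m)) :
  Retr (A *m B) = Retr (B *m A).
Proof. by rewrite /Retr mxtrace_mulC. Qed.

Lemma Retr_adj n (A : 'M[R[i]]_n) : Retr (adjmx A) = Retr A.
Proof.
rewrite /Retr /mxtrace !raddf_sum; apply: eq_bigr => i _.
by rewrite adjmxE; exact: Re_conjC.
Qed.

Lemma psdmx_adj n (A : 'M[R[i]]_n) : psdmx A -> adjmx A = A.
Proof. by case/psdmxP. Qed.

Lemma psdmxD n (A B : 'M[R[i]]_n) : psdmx A -> psdmx B -> psdmx (A + B).
Proof.
move=> /psdmxP[hA pA] /psdmxP[hB pB]; apply/psdmxP; split.
  by rewrite adjmxD hA hB.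
by move=> u; rewrite mulmxDr mulmxDl mxE addr_ge0.
Qed.

Lemma psdmxZ n x (A : 'M[R[i]]_n) : 0 <= x -> psdmx A -> psdmx (toC x *: A).
Proof.
move=> x0 /psdmxP[hA pA]; apply/psdmxP; split; first by rewrite adjmxZ hA.
by move=> u; rewrite -scalemxAr -scalemxAl mxE mulr_ge0// toC_ge0.
Qed.

Lemma psdmx_congr m n (X : 'M[R[i]]_(n, m)) (A : 'M[R[i]]_n) :
  psdmx A -> psdmx (adjmx X *m A *m X).
Proof.
move=> /psdmxP[hA pA]; apply/psdmxP; split.
  by rewrite !adjmxM adjmxK hA mulmxA.
by move=> u; have := pA (X *m u); rewrite adjmxM !mulmxA.
Qed.

Lemma psdmx1 n : psdmx (1%:M : 'M[R[i]]_n).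
Proof.
apply/psdmxP; split; first exact: adjmx1.
move=> u; rewrite mulmx1 mxE; apply: sumr_ge0 => i _.
by rewrite adjmxE mulrC mul_conjC_ge0.
Qed.

Lemma psdmx_gram m n (X : 'M[R[i]]_(n, m)) : psdmx (adjmx X *m X).
Proof. by have := psdmx_congr X (psdmx1 n); rewrite mulmx1. Qed.

Lemma gram_eq0 m n (X : 'M[R[i]]_(n, m)) : adjmx X *m X = 0 -> X = 0.
Proof.
move=> X0; apply/matrixP => i j; rewrite mxE; apply/eqP.
have /eqP := congr1 (fun A : 'M[R[i]]_m => A j j) X0; rewrite mxE mxE.
rewrite psumr_eq0; last by move=> k _; rewrite adjmxE mulrC mul_conjC_ge0.
by move=> /allP /(_ i (mem_index_enum _)) /=; rewrite adjmxE mulrC mul_conjC_eq0.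
Qed.

Lemma Retr_psd_ge0 n (A B : 'M[R[i]]_n) :
  psdmx A -> psdmx B -> 0 <= Retr (A *m B).
Proof.
move=> pA pB; have := psd_mxtrace_ge0 pA pB.
by rewrite /Retr lecE => /andP[].
Qed.

Lemma herm_spectral n (A : 'M[R[i]]_n) : A \is hermsymmx ->
  exists (P : 'M[R[i]]_n) (d : 'I_n -> R),
    [/\ P *m adjmx P = 1%:M, adjmx P *m P = 1%:M
      & A = adjmx P *m rdiag d *m P].
Proof.
move=> hA; exists (spectralmx A), (fun i => complex.Re (spectral_diag A 0 i)).
have /unitarymxP uP := spectral_unitarymx A.
split; [exact: uP|exact: mulmx1C|].
rewrite /adjmx -invmx_unitary ?spectral_unitarymx// /rdiag.
have -> : \row_i toC (complex.Re (spectral_diag A 0 i)) = spectral_diag A.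
  apply/rowP => i; rewrite mxE.
  have /mxOverP/(_ 0 i) := hermitian_spectral_diag_real hA.
  exact: RRe_real.
exact/orthomx_spectralP/hermitian_normalmx.
Qed.

Section spectral_decomposition.
Variables (n : nat) (P A : 'M[R[i]]_n) (d : 'I_n -> R).
Hypotheses (PaP : P *m adjmx P = 1%:M) (AE : A = adjmx P *m rdiag d *m P).

(** These columns are an orthonormal eigenbasis of [A], with [u i] belonging to the eigenvalue
    [d i]. *)
Let u i : 'cV[R[i]]_n := adjmx (row i P).

Let rP i : row i P *m adjmx P = delta_mx 0 i.
Proof. by rewrite -row_mul PaP rowE mulmx1. Qed.

Let uE i : u i = adjmx P *m delta_mx i 0.
Proof.
rewrite /u rowE adjmxM; congr (_ *m _).
by apply/matrixP => x y; rewrite adjmxE !mxE andbC conjC_nat.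
Qed.

Lemma adj_spectral_row i : adjmx (u i) *m u i = 1%:M.
Proof.
rewrite {1}/u adjmxK uE mulmxA rP mul_delta_mx.
by apply/matrixP => a b; rewrite !ord1 !mxE.
Qed.

Lemma spectral_diagE i : toC (d i) = (adjmx (u i) *m A *m u i) 0 0.
Proof.
rewrite {1}/u adjmxK AE !mulmxA rP uE mulmxA -(mulmxA _ P) PaP mulmx1.
by rewrite -rowE -colE !mxE eqxx.
Qed.

Lemma tr_spectral : \tr A = toC (\sum_i d i).
Proof.
rewrite AE mxtrace_mulC mulmxA PaP mul1mx mxtrace_diag toC_sum.
by apply: eq_bigr => i _; rewrite mxE.
Qed.

Lemma Retr_spectral : Retr A = \sum_i d i.
Proof. by rewrite /Retr tr_spectral. Qed.

Lemma psdmx_spectral_ge0 i : psdmx A -> 0 <= d i.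
Proof. by case/psdmxP => _ pA; rewrite -toC_ge0 spectral_diagE. Qed.

Lemma posdefmx_spectral_gt0 i : posdefmx A -> 0 < d i.
Proof.
case/posdefmxP => _ pA; rewrite -ltcR; change (0 < toC (d i)); rewrite spectral_diagE.
apply: pA; apply/eqP => u0; have := congr1 (fun B : 'M[R[i]]_1 => B 0 0) (adj_spectral_row i).
by rewrite u0 mulmx0 !mxE eqxx => /esym/eqP; rewrite oner_eq0.
Qed.

End spectral_decomposition.

Lemma mul_rdiag_mx m n (d : 'I_n -> R) (A : 'M[R[i]]_(n, m)) k l :
  (rdiag d *m A) k l = toC (d k) * A k l.
Proof. by rewrite /rdiag mul_diag_mx !mxE. Qed.

Lemma mul_mx_rdiag m n (d : 'I_n -> R) (A : 'M[R[i]]_(m, n)) k l :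
  (A *m rdiag d) k l = A k l * toC (d l).
Proof. by rewrite /rdiag mul_mx_diag !mxE. Qed.

Lemma rdiag_cst n x : rdiag (fun _ : 'I_n => x) = (toC x)%:M.
Proof. by apply/matrixP => i j; rewrite !mxE. Qed.

Lemma rdiagB n (d e : 'I_n -> R) :
  rdiag (fun i => d i - e i) = rdiag d - rdiag e.
Proof. by apply/matrixP => i j; rewrite !mxE toCB mulrnBl. Qed.

Lemma adj_rdiag n (d : 'I_n -> R) : adjmx (rdiag d) = rdiag d.
Proof.
apply/matrixP => i j; rewrite adjmxE !mxE eq_sym.
by have [->|ij] := eqVneq i j; rewrite ?mulr1n ?conjC_toC// !mulr0n conjC0.
Qed.

Lemma psdmx_rdiag n (d : 'I_n -> R) : (forall i, 0 <= d i) -> psdmx (rdiag d).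
Proof.
move=> d0; apply/psdmxP; split; first exact: adj_rdiag.
move=> u; rewrite mxE; apply: sumr_ge0 => i _.
rewrite mul_mx_diag mxE adjmxE mxE mulrAC mulr_ge0 ?toC_ge0//.
by rewrite mulrC mul_conjC_ge0.
Qed.

Lemma psdmx_tr0 n (A : 'M[R[i]]_n) : psdmx A -> Retr A <= 0 -> A = 0.
Proof.
move=> pA; have [P [d [PaP _ AE]]] := herm_spectral pA.1.
have d0 i : 0 <= d i := psdmx_spectral_ge0 PaP AE i pA.
rewrite (Retr_spectral PaP AE) => sd.
have : \sum_i d i == 0 by rewrite eq_le sd sumr_ge0.
rewrite psumr_eq0// => /allP {}sd; rewrite AE.
have -> : rdiag d = 0.
  apply/matrixP => i j; rewrite !mxE (eqP (sd i _)) ?mem_index_enum//.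
  by rewrite mul0rn.
by rewrite mulmx0 mul0mx.
Qed.

Lemma form_Retr n (A : 'M[R[i]]_n) (u : 'cV[R[i]]_n) :
  complex.Re ((adjmx u *m A *m u) 0 0) = Retr (u *m adjmx u *m A).
Proof. by rewrite -[u *m _ *m A]mulmxA RetrC /Retr trace_mx11. Qed.

(** The quadratic form of a Hermitian matrix is real, so it suffices to test its real part, written
    as a trace against [u u^*]. *)
Lemma psdmx_Retr n (A : 'M[R[i]]_n) : adjmx A = A ->
  (forall u : 'cV[R[i]]_n, 0 <= Retr (u *m adjmx u *m A)) -> psdmx A.
Proof.
move=> hA pA; apply/psdmxP; split=> // u.
rewrite lecE form_Retr pA andbT eq_sym; apply/eqP.
have : adjmx (adjmx u *m A *m u) = adjmx u *m A *m u.
  by rewrite !adjmxM adjmxK hA mulmxA.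
move/(congr1 (fun B : 'M[R[i]]_1 => B 0 0)); rewrite adjmxE.
case: (_ 0 0) => a b [] /eqP.
by rewrite eq_sym -addr_eq0 -mulr2n mulrn_eq0/= => /eqP.
Qed.

(** Factoring [A = Y^* Y] through the square roots of the eigenvalues makes the form the squared
    norm of [Y u], so [Y u = 0]. *)
Lemma psdmx_form0 n (A : 'M[R[i]]_n) (u : 'cV[R[i]]_n) :
  psdmx A -> Retr (u *m adjmx u *m A) = 0 -> A *m u = 0.
Proof.
move=> pA; have [P [d [PaP _ AE]]] := herm_spectral pA.1.
have d0 i : 0 <= d i := psdmx_spectral_ge0 PaP AE i pA.
pose Y := rdiag (fun i => Num.sqrt (d i)) *m P.
have YY : A = adjmx Y *m Y.
  rewrite AE /Y adjmxM adj_rdiag !mulmxA; congr (_ *m _); rewrite -!mulmxA.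
  congr (_ *m _); apply/matrixP => i j; rewrite mul_diag_mx !mxE.
  have [->|ij] := eqVneq i j; last by rewrite !mulr0n mulr0.
  by rewrite !mulr1n -toCM -expr2 sqr_sqrtr.
move=> uA.
have Yu : Retr (adjmx (Y *m u) *m (Y *m u)) = 0.
  by rewrite -uA YY adjmxM -[in RHS]mulmxA [in RHS]RetrC !mulmxA.
rewrite YY -mulmxA (_ : Y *m u = 0) ?mulmx0//.
by apply: gram_eq0; apply: psdmx_tr0; [exact: psdmx_gram|rewrite Yu].
Qed.

Lemma posdef_psd n (A : 'M[R[i]]_n) : posdefmx A -> psdmx A.
Proof.
move=> /posdefmxP[hA pA]; apply/psdmxP; split=> // u.
have [->|u0] := eqVneq u 0; first by rewrite mulmx0 mxE.
exact/ltW/pA.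
Qed.

Lemma psdmx_tr_sub n (A : 'M[R[i]]_n) : psdmx A -> psdmx ((toC (Retr A))%:M - A).
Proof.
move=> pA; have [P [d [PaP aPP AE]]] := herm_spectral pA.1.
have d0 i : 0 <= d i := psdmx_spectral_ge0 PaP AE i pA.
have -> : (toC (Retr A))%:M - A =
    adjmx P *m rdiag (fun i => Retr A - d i) *m P.
  rewrite rdiagB rdiag_cst mulmxBr mulmxBl -AE; congr (_ - _).
  by rewrite scalar_mxC -mulmxA aPP mulmx1.
apply/psdmx_congr/psdmx_rdiag => i.
rewrite (Retr_spectral PaP AE) (bigD1 i)//= addrAC subrr add0r.
exact: sumr_ge0.
Qed.

Lemma posdef_lower n (A : 'M[R[i]]_n) : posdefmx A ->
  exists2 e : R, 0 < e & psdmx (A - (toC e)%:M).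
Proof.
move=> pA; have [P [d [PaP aPP AE]]] := herm_spectral pA.1.
have d0 i : 0 < d i := posdefmx_spectral_gt0 PaP AE i pA.
have [e e0 ed] : exists2 e : R, 0 < e & forall i, e <= d i.
  (* Starting the minimum at 1 keeps it positive also for [n = 0]. *)
  exists (\big[Num.min/1]_i d i); first by apply: lt_bigmin.
  by move=> i; exact: bigmin_le_cond.
exists e => //.
have -> : A - (toC e)%:M = adjmx P *m rdiag (fun i => d i - e) *m P.
  rewrite rdiagB rdiag_cst mulmxBr mulmxBl -AE; congr (_ - _).
  by rewrite scalar_mxC -mulmxA aPP mulmx1.
by apply/psdmx_congr/psdmx_rdiag => i; rewrite subr_ge0.
Qed.

(** With [A >= e] and [B <= tr B], the factor [tr B / e] works. This carries integrability from one
    strictly positive state to all states. *)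
Lemma posdef_dominates n (A B : 'M[R[i]]_n) : posdefmx A -> psdmx B ->
  exists2 c : R, 0 <= c & psdmx (toC c *: A - B).
Proof.
move=> pA pB; have [e e0 pAe] := posdef_lower pA.
have tB : 0 <= Retr B by have := Retr_psd_ge0 pB (psdmx1 n); rewrite mulmx1.
have c0 : 0 <= Retr B / e by rewrite divr_ge0// ltW.
exists (Retr B / e); first exact: c0.
have -> : toC (Retr B / e) *: A - B =
    toC (Retr B / e) *: (A - (toC e)%:M) + ((toC (Retr B))%:M - B).
  rewrite scalerBr scale_scalar_mx -toCM divfK ?gt_eqF//.
  by rewrite addrA subrK.
by apply: psdmxD; [exact: psdmxZ|exact: psdmx_tr_sub].
Qed.

(** Some multiple [c A] dominates the identity, so [tr B <= c tr (A B) <= 0]. *)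
Lemma posdef_Retr0 n (A B : 'M[R[i]]_n) :
  posdefmx A -> psdmx B -> Retr (A *m B) <= 0 -> B = 0.
Proof.
move=> pA pB AB; have [c c0 pc] := posdef_dominates pA (psdmx1 n).
apply: psdmx_tr0 => //; have := Retr_psd_ge0 pc pB.
rewrite mulmxBl mul1mx -scalemxAl RetrD RetrN RetrZ => h.
by have := mulr_ge0_le0 c0 AB; move: h; move: (c * _) (Retr B) => a b; lra.
Qed.

(** Equality case of Cauchy-Schwarz for the form [Re tr (A X Y)]: the residual [D = B - L / I] has
    squared norm [Re tr (A B B) - 1 / I <= 0], and strict positivity of [A] gives [D = 0]. *)
Lemma score_Cauchy_Schwarz_eq n (A B L : 'M[R[i]]_n) :
  posdefmx A -> adjmx B = B -> adjmx L = L ->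
  let I := Retr (A *m (L *m L)) in
  Retr (A *m (L *m B)) = 1 -> Retr (A *m (B *m B)) <= I^-1 ->
  B = toC I^-1 *: L /\ Retr (A *m (B *m B)) = I^-1.
Proof.
move=> pA hB hL I LB BB.
have [hA _] := (posdefmxP A).1 pA.
have BL : Retr (A *m (B *m L)) = 1.
  by rewrite -LB -Retr_adj !adjmxM hA hB hL RetrC.
pose D := B - toC I^-1 *: L.
have hD : adjmx D = D by rewrite adjmxD adjmxN adjmxZ hB hL.
have DD : Retr (A *m (D *m D)) = Retr (A *m (B *m B)) - I^-1.
  rewrite /D !(mulmxDl, mulmxDr, mulmxN, mulNmx) -!(scalemxAr, scalemxAl).
  rewrite !(RetrD, RetrN, RetrZ) LB BL -/I.
  (* For [I = 0] the inverse is 0 by convention and the identity persists. *)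
  have -> : I^-1 * (I^-1 * I) = I^-1.
    have [->|I0] := eqVneq I 0; first by rewrite invr0 mul0r.
    by rewrite mulVf ?mulr1.
  by move: (Retr _) (I^-1) => a b; lra.
have pDD : psdmx (D *m D) by rewrite -[X in X *m _]hD; exact: psdmx_gram.
have DD0 : D *m D = 0.
  by apply: (posdef_Retr0 pA pDD); rewrite DD subr_le0.
split.
  by apply/eqP; rewrite -subr_eq0 -/D; apply/eqP/gram_eq0; rewrite hD.
move: DD; rewrite DD0 mulmx0 {1}/Retr mxtrace0 => /esym/eqP.
by rewrite subr_eq0 => /eqP.
Qed.

End hermitian_matrices.

(** * Moments of a statistic as operators *)

Section operator_valued_moments.
Context (R : realType) (n : nat) d (X : measurableType d).
Variable M : measurement R n X.
Implicit Types (sigma : state R n) (u v : 'cV[R[i]]_n).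

Lemma lawE sigma (A : set X) : measurable A ->
  law sigma M A = (Retr (sigma *m M A))%:E.
Proof. by move=> mA; rewrite /law; case: asboolP. Qed.

(** Here [c] is the squared norm of [u]. Statements about all states thereby reach every quadratic
    form. *)
Lemma pure_state u : u != 0 ->
  exists (sigma : state R n) (c : R), u *m adjmx u = toC c *: (sigma : 'M[R[i]]_n).
Proof.
move=> u0; pose c := Retr (u *m adjmx u).
have pu : psdmx (u *m adjmx u).
  by have := psdmx_gram (adjmx u); rewrite adjmxK.
have c0 : 0 < c.
  rewrite lt_neqAle andbC; have := Retr_psd_ge0 pu (psdmx1 R n).
  rewrite mulmx1 => -> /=; apply: contra u0 => /eqP c0.
  have := psdmx_tr0 pu; rewrite -/c -c0 => /(_ (lexx _)) uu.
  by rewrite -[u]adjmxK (@gram_eq0 _ _ _ (adjmx u)) ?adjmxK// /adjmx trmx0 map_mx0.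
have tu : \tr (u *m adjmx u) = toC c.
  have [/esym h _] := (psdmxP _).1 pu.
  have : \tr (u *m adjmx u) = Num.conj (\tr (u *m adjmx u)).
    rewrite {1}h /mxtrace rmorph_sum; apply: eq_bigr => i _.
    by rewrite adjmxE.
  rewrite /c /Retr; case: (\tr _) => a b [] /eqP.
  by rewrite -addr_eq0 -mulr2n mulrn_eq0/= => /eqP ->.
have ps : psdmx (toC c^-1 *: (u *m adjmx u)).
  by apply: psdmxZ => //; rewrite invr_ge0 ltW.
have ts : \tr (toC c^-1 *: (u *m adjmx u)) = 1.
  by rewrite linearZ /= tu -[LHS]toCM mulVf ?gt_eqF.
exists (State ps ts), c => /=.
by rewrite scalerA -toCM mulfV ?gt_eqF// scale1r.
Qed.

Lemma RetrE m (A B : 'M[R[i]]_m) : Retr (A *m B) =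
  \sum_i \sum_j (complex.Re (A i j) * complex.Re (B j i) -
                 complex.Im (A i j) * complex.Im (B j i)).
Proof.
rewrite /Retr /mxtrace raddf_sum; apply: eq_bigr => i _.
rewrite mxE raddf_sum; apply: eq_bigr => j _.
by case: (A i j) (B j i) => a b [].
Qed.

(** Taking for [A] the adjoint of [B - C] produces the squared Hilbert-Schmidt norm of [B - C]. *)
Lemma Retr_inj m (B C : 'M[R[i]]_m) :
  (forall A, Retr (A *m B) = Retr (A *m C)) -> B = C.
Proof.
move=> BC; apply/eqP; rewrite -subr_eq0; apply/eqP/gram_eq0/psdmx_tr0.
  exact: psdmx_gram.
by rewrite mulmxBr RetrD RetrN BC subrr.
Qed.

(** For Hermitian [H] the two cross terms have the same real trace, so three quadratic forms
    suffice. *)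
Lemma polarization (H : 'M[R[i]]_n) u v : adjmx H = H ->
  Retr (u *m adjmx v *m H) = 2^-1 * (Retr ((u + v) *m adjmx (u + v) *m H) -
    Retr (u *m adjmx u *m H) - Retr (v *m adjmx v *m H)).
Proof.
move=> hH; rewrite adjmxD mulmxDl !mulmxDr !mulmxDl !RetrD.
have -> : Retr (v *m adjmx u *m H) = Retr (u *m adjmx v *m H).
  by rewrite -Retr_adj !adjmxM adjmxK hH RetrC.
by move: (Retr _) (Retr _) (Retr _) => a b c; field.
Qed.

(** Convergence of expectations gives that of quadratic forms by [pure_state], then of sesquilinear
    ones by [polarization], hence of the entries. The limit is Hermitian because [Re tr (A H_k)] is
    unchanged when [A] is replaced by its adjoint. *)
Lemma herm_mx_cvg (H : nat -> 'M[R[i]]_n) :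
  (forall k, adjmx (H k) = H k) ->
  (forall sigma, cvgn (fun k => Retr (sigma *m H k))) ->
  exists2 L : 'M[R[i]]_n, adjmx L = L &
    forall A, (fun k => Retr (A *m H k)) @ \oo --> Retr (A *m L).
Proof.
move=> hH cH.
have cq u : cvgn (fun k => Retr (u *m adjmx u *m H k)).
  have [->|/pure_state[sigma [c ->]]] := eqVneq u 0.
    by under eq_fun do rewrite !mul0mx /Retr mxtrace0; exact: is_cvg_cst.
  under eq_fun do rewrite -scalemxAl RetrZ.
  by apply: is_cvgM; [exact: is_cvg_cst|exact: cH].
have cp u v : cvgn (fun k => Retr (u *m adjmx v *m H k)).
  under eq_fun do rewrite polarization//.
  apply: is_cvgM; first exact: is_cvg_cst.
  by apply: is_cvgB => //; apply: is_cvgB.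
pose e i : 'cV[R[i]]_n := delta_mx i 0.
have eE (A : 'M[R[i]]_n) i j : \tr (adjmx (e i) *m (A *m e j)) = A i j.
  rewrite -colE trace_mx11 mxE (bigD1 i)//= big1 => [|l li].
    by rewrite adjmxE !mxE !eqxx conjC1 mul1r addr0.
  by rewrite adjmxE !mxE (negbTE li) conjC0 mul0r.
have ReE k i j : complex.Re (H k i j) = Retr (e j *m adjmx (e i) *m H k).
  by rewrite -mulmxA RetrC -mulmxA /Retr eE.
(* An imaginary part is the real part after multiplication by [-i], a scalar that can be moved onto
   [e j]. *)
have ImE k i j : complex.Im (H k i j) =
    Retr (((0 -i* 1)%C : R[i]) *: e j *m adjmx (e i) *m H k).
  rewrite -mulmxA RetrC -mulmxA -!scalemxAr /Retr linearZ /= eE.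
  by case: (H k i j) => a b /=; rewrite mul0r sub0r mulN1r opprK.
have cRe i j : cvgn (fun k => complex.Re (H k i j)).
  by under eq_fun do rewrite ReE; exact: cp.
have cIm i j : cvgn (fun k => complex.Im (H k i j)).
  by under eq_fun do rewrite ImE; exact: cp.
pose L : 'M[R[i]]_n := \matrix_(i, j)
  (limn (fun k => complex.Re (H k i j)) +i*
   limn (fun k => complex.Im (H k i j))).
have cL A : (fun k => Retr (A *m H k)) @ \oo --> Retr (A *m L).
  rewrite RetrE; under eq_fun do rewrite RetrE.
  apply: cvg_big => [|i _]; first exact: add_continuous.
  apply: cvg_big => [|j _]; first exact: add_continuous.
  rewrite !mxE /=; apply: cvgB; apply: cvgMl_tmp.
    exact: cRe.
  exact: cIm.
exists L => //; apply: Retr_inj => A.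
have -> : Retr (A *m adjmx L) = Retr (adjmx A *m L).
  by rewrite -Retr_adj adjmxM adjmxK RetrC.
have := cL (adjmx A).
under eq_fun => k do rewrite -Retr_adj adjmxM adjmxK hH RetrC.
by move/(cvg_unique (@Rhausdorff R)) => /(_ _ (cL A)) ->.
Qed.

Lemma measurable_fiber (g : X -> R) (y : R) :
  measurable_fun setT g -> measurable (g @^-1` [set y]).
Proof. by move=> mg; rewrite -[X in measurable X]setTI; exact: mg. Qed.

(** If [s] is duplicate-free and contains all values of [g], this is the integral of [h o g] against
    the operator-valued measure [M]. *)
Definition simple_moment (s : seq R) (g : X -> R) (h : R -> R) : 'M[R[i]]_n :=
  \sum_(y <- s) toC (h y) *: M (g @^-1` [set y]).

(** Expand [h (g x)] over the indicators of the fibres of [g]; only the term [y = g x] is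
    nonzero. *)
Lemma integral_simple (sigma : state R n) (s : seq R) (g : X -> R) (h : R -> R) :
  measurable_fun setT g -> uniq s -> (forall x, g x \in s) ->
  (\int[law sigma M]_x (h (g x))%:E)%E =
    (Retr (sigma *m simple_moment s g h))%:E.
Proof.
move=> mg us sg.
have mA y := measurable_fiber y mg.
have iA y : (law sigma M).-integrable setT (EFin \o \1_(g @^-1` [set y])).
  exact: integrable_indic.
under eq_integral => x _.
  have -> : (h (g x))%:E =
      (\sum_(y <- s) ((h y)%:E * (\1_(g @^-1` [set y]) x)%:E))%E.
    rewrite (bigD1_seq (g x))//= big1 => [|y yg].
      by rewrite indicE mem_set// mule1 adde0.
    by rewrite indicE memNset ?mule0//= => gy; move: yg; rewrite gy eqxx.
  over.
rewrite integral_sum//; last by move=> y; apply: integrableZl => //; exact: iA.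
rewrite mulmx_sumr Retr_sum -sumEFin.
apply: eq_bigr => y _.
rewrite integralZl//; [|exact: iA]. rewrite integral_indic// setIT [X in (_ * X)%E]lawE//.
by rewrite -EFinM -scalemxAr -RetrZ.
Qed.

Lemma simple_moment_adj s g h : measurable_fun setT g ->
  adjmx (simple_moment s g h) = simple_moment s g h.
Proof.
move=> mg; rewrite /simple_moment.
elim/big_ind: _ => [|A B hA hB|y _].
- by rewrite /adjmx trmx0 map_mx0.
- by rewrite adjmxD hA hB.
- rewrite adjmxZ (psdmx_adj (meas_psd M _))//.
  exact: measurable_fiber.
Qed.


(* For the simple function g this is the expansion of
   \sum_y (y u - w)^* M(g = y) (y u - w). *)
Lemma simple_moment_psd s g (u w : 'cV[R[i]]_n) : measurable_fun setT g ->
  0 <= Retr (u *m adjmx u *m simple_moment s g (fun y => y ^+ 2))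
     - 2 * Retr (u *m adjmx w *m simple_moment s g id)
     + Retr (w *m adjmx w *m simple_moment s g (fun=> 1)).
Proof.
move=> mg.
rewrite /simple_moment !mulmx_sumr !Retr_sum mulr_sumr -sumrN -!big_split/=.
apply: sumr_ge0 => y _; rewrite -3!scalemxAr 3!RetrZ mul1r.
have pM : psdmx (M (g @^-1` [set y])).
  by apply: meas_psd; exact: measurable_fiber.
set A := M _ in pM *; have hA := psdmx_adj pM.
have pv : psdmx ((toC y *: u - w) *m adjmx (toC y *: u - w)).
  by have := psdmx_gram (adjmx (toC y *: u - w)); rewrite adjmxK.
have := Retr_psd_ge0 pv pM.
rewrite adjmxD adjmxN adjmxZ !(mulmxDl, mulmxDr, mulmxN, mulNmx).
rewrite -!(scalemxAr, scalemxAl) !(RetrD, RetrN, RetrZ).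
have -> : Retr (w *m adjmx u *m A) = Retr (u *m adjmx w *m A).
  by rewrite -Retr_adj !adjmxM adjmxK hA RetrC.
by move: (Retr _) (Retr _) (Retr _) => a b c h; nra.
Qed.

(** Nonnegative simple functions increasing to [|t|] are given the sign of [t], which also yields
    the bound used later for domination. *)
Lemma simple_approximation (t : X -> R) : measurable_fun setT t ->
  exists (g : nat -> X -> R) (s : nat -> seq R),
    [/\ forall k, measurable_fun setT (g k), forall k, uniq (s k),
        forall k x, g k x \in s k, forall k x, `|g k x| <= `|t x|
      & forall x, g ^~ x @ \oo --> t x].
Proof.
move=> mt.
pose f (x : X) : \bar R := (`|t x|)%:E.
have mf : measurable_fun [set: X] f.
  by apply/measurable_EFinP; apply: measurableT_comp.
pose a := nnsfun_approx measurableT mf.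
have f0 x : setT x -> (0 <= f x)%E by rewrite lee_fin.
pose g k x := if 0 <= t x then a k x else - a k x.
have fa k : finite_set (range (a k)) by exact: fimfunP.
pose S k := (range (a k) `|` -%R @` range (a k))%classic.
have fS k : finite_set (S k).
  by rewrite finite_setU; split => //; exact: finite_image.
exists g, (fun k => finmap.enum_fset (fset_set (S k))); split.
- move=> k; apply: measurable_fun_ifT => //.
    by apply: measurable_fun_ler.
  by apply: measurableT_comp.
- by move=> k; exact: finmap.fset_uniq.
- move=> k x; rewrite in_fset_set// inE /g; case: ifP => _.
    by left; exists x.
  by right; exists (a k x) => //; exists x.
- move=> k x; have -> : `|g k x| = a k x.
    by rewrite /g; case: ifP => _; rewrite ?normrN ger0_norm.
  by rewrite -lee_fin nnsfun_approxE; exact: le_approx.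
- move=> x.
  have ca : (fun k => a k x) @ \oo --> `|t x|.
    have := cvg_nnsfun_approx measurableT mf f0 (x := x) I.
    by move/fine_cvgP => [].
  rewrite /g; have [t0|t0] := leP 0 (t x).
    by rewrite -(ger0_norm t0).
  rewrite -[X in _ --> X]opprK -(ltr0_norm t0); exact: cvgN.
Qed.

Lemma le_law (rho sigma : state R n) (c : {nonneg R}) :
  psdmx (toC c%:num *: (rho : 'M[R[i]]_n) - (sigma : 'M[R[i]]_n)) ->
  forall A, measurable A -> (law sigma M A <= mscale c (law rho M) A)%E.
Proof.
move=> pc A mA; rewrite /mscale/= !lawE// -EFinM lee_fin -RetrZ scalemxAl.
rewrite -subr_ge0 -RetrN -RetrD -mulmxBl; apply: (Retr_psd_ge0 pc).
exact: meas_psd.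
Qed.

(** * First and second moment operators under a finite second moment *)

Section second_moment.
Variables (t : X -> R) (rho : state R n) (a0 : R).
Hypotheses (mt : measurable_fun setT t) (prho : posdefmx rho).
Hypothesis fin : (\int[law rho M]_x ((t x - a0) ^+ 2)%:E < +oo)%E.

Let msqr : measurable_fun setT (fun x => (t x - a0) ^+ 2).
Proof. by apply: measurable_funX; apply: measurable_funB. Qed.

(** Strict positivity of [rho] gives [sigma <= c rho], hence the same inequality between the laws,
    and the finite integral under [rho] bounds the one under [sigma]. *)
Lemma square_integrable sigma :
  (law sigma M).-integrable setT (fun x => ((t x - a0) ^+ 2)%:E).
Proof.
apply/integrableP; split; first exact/measurable_EFinP.
have [c c0 pc] := posdef_dominates prho (state_psd sigma).
pose c' : {nonneg R} := NngNum c0.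
under eq_integral do rewrite gee0_abs ?lee_fin ?sqr_ge0//.
apply: (@le_lt_trans _ _ (\int[mscale c' (law rho M)]_x ((t x - a0) ^+ 2)%:E)%E).
  apply: ge0_le_measure_integral => //.
  - exact: le_law.
  - by move=> x; rewrite lee_fin sqr_ge0.
  - exact/measurable_EFinP.
rewrite ge0_integral_mscale//; last 2 first.
  - exact/measurable_EFinP.
  - by move=> x _; rewrite lee_fin sqr_ge0.
by rewrite lte_mul_pinfty// lee_fin.
Qed.

(** Dominated convergence: quadratic growth of [h] provides an integrable majorant affine in
    [(t - a0)^2]. *)
Lemma simple_moment_cvg sigma (g : nat -> X -> R) (s : nat -> seq R)
    (h : R -> R) (C : R) :
  (forall k, measurable_fun setT (g k)) -> (forall k, uniq (s k)) ->
  (forall k x, g k x \in s k) -> (forall k x, `|g k x| <= `|t x|) ->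
  (forall x, g ^~ x @ \oo --> t x) ->
  continuous h -> 0 <= C -> (forall y, `|h y| <= C * (1 + y ^+ 2)) ->
  exists2 m : R, (\int[law sigma M]_x (h (t x))%:E)%E = m%:E &
    (fun k => Retr (sigma *m simple_moment (s k) (g k) h)) @ \oo --> m.
Proof.
move=> mg us sg gt cg ch C0 hC.
pose G x : \bar R := (C * (1 + 2 * a0 ^+ 2) + (2 * C) * (t x - a0) ^+ 2)%:E.
have mh : measurable_fun setT h by exact: continuous_measurable_fun.
have iG : (law sigma M).-integrable setT G.
  apply: (@integrableD _ _ _ _ _ measurableT (fun=> (C * (1 + 2 * a0 ^+ 2))%:E)
    (fun x => ((2 * C)%:E * ((t x - a0) ^+ 2)%:E)%E)).
    exact: finite_measure_integrable_cst.
  by apply: integrableZl => //; exact: square_integrable.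
have [] := @dominated_convergence _ _ _ (law sigma M) setT measurableT
  (fun k x => (h (g k x))%:E) (fun x => (h (t x))%:E) G.
- by move=> k; apply/measurable_EFinP; apply: measurableT_comp.
- by apply/measurable_EFinP; apply: measurableT_comp.
- apply: aeW => x _; apply: cvg_EFin; first exact: nearW.
  by apply: continuous_cvg => //; exact: ch.
- exact: iG.
- apply: aeW => x k _; rewrite lee_fin.
  apply: (le_trans (hC _)); rewrite -[g k x ^+ 2]real_normK ?num_real//.
  have : `|g k x| ^+ 2 <= t x ^+ 2.
    by rewrite -[t x ^+ 2]real_normK ?num_real// lerXn2r ?nnegrE.
  set y := _ ^+ 2; set z := t x => yz.
  (* This amounts to [(z - 2 a0)^2 >= 0] and explains the constants in [G]. *)
  have : y <= 2 * a0 ^+ 2 + 2 * (z - a0) ^+ 2.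
    by apply: (le_trans yz); have := sqr_ge0 (z - 2 * a0); nra.
  move=> h1.
  have : C * (1 + y) <= C * (1 + (2 * a0 ^+ 2 + 2 * (z - a0) ^+ 2)).
    by rewrite ler_wpM2l// lerD2l.
  by move: (_ ^+ 2) => w h2; lra.
move=> ih _ cvh.
have fm : (\int[law sigma M]_x (h (t x))%:E)%E \is a fin_num.
  exact: integrable_fin_num ih.
exists (fine (\int[law sigma M]_x (h (t x))%:E)%E); first by rewrite fineK.
rewrite -(fineK fm) in cvh; have [_] := (fine_cvgP _ _).1 cvh.
by under eq_fun do rewrite /= (integral_simple sigma _ (mg _) (us _) (sg _)).
Qed.

(** Expanding [(y - a)^2] for simple functions reduces the moments around every centre [a] to the
    two limits [T] and [S]. *)
Lemma moment_operators : exists T S : 'M[R[i]]_n,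
  [/\ adjmx T = T, adjmx S = S, psdmx (S - T *m T),
      forall sigma, (\int[law sigma M]_x (t x)%:E)%E = (Retr (sigma *m T))%:E &
      forall sigma a, (\int[law sigma M]_x ((t x - a) ^+ 2)%:E)%E =
        (Retr (sigma *m (S - toC (2 * a) *: T + toC (a ^+ 2) *: 1%:M)))%:E].
Proof.
have [g [s [mg us sg gt cg]]] := simple_approximation mt.
have cvh sigma := @simple_moment_cvg sigma g s _ _ mg us sg gt cg.
pose I k h := simple_moment (s k) (g k) h.
have cid sigma : exists2 m : R, (\int[law sigma M]_x (t x)%:E)%E = m%:E &
    (fun k => Retr (sigma *m I k id)) @ \oo --> m.
  have [|||m e1 e2] := cvh id 1 sigma; last by exists m.
    by move=> y; exact: cvg_id.
  - exact: ler01.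
  - move=> y.
  rewrite mul1r ler_norml; have := sqr_ge0 (y - 1); have := sqr_ge0 (y + 1).
  by move=> h1 h2; apply/andP; split; nra.
have csq a sigma : exists2 m : R,
    (\int[law sigma M]_x ((t x - a) ^+ 2)%:E)%E = m%:E &
    (fun k => Retr (sigma *m I k (fun y => (y - a) ^+ 2))) @ \oo --> m.
  (* The constant comes from [(y - a)^2 <= 2 y^2 + 2 a^2 <= (2 + 2 a^2) (1 + y^2)]. *)
  have [|||m e1 e2] := cvh (fun y => (y - a) ^+ 2) (2 + 2 * a ^+ 2) sigma;
    last by exists m.
  - move=> y. apply: (@continuous_comp _ _ _ (fun y => y - a) (fun y : R => y ^+ 2)).
      by apply: cvgB; [exact: cvg_id|exact: cvg_cst].
    exact: exprn_continuous.
  - by have := sqr_ge0 a; lra.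
  - move=> y; rewrite ger0_norm ?sqr_ge0//.
    have := sqr_ge0 a; have := sqr_ge0 y; have := sqr_ge0 (y + a).
    by have := mulr_ge0 (sqr_ge0 a) (sqr_ge0 y); nra.
have I1 sigma k : Retr (sigma *m I k (fun=> 1)) = 1.
  have := integral_simple sigma (fun=> 1) (mg k) (us k) (sg k).
  rewrite (_ : \int[_]_x _ = 1)%E => [[<-]//|].
  by rewrite integral_cst// mul1e; exact: probability_setT.
have [T hT cT] := @herm_mx_cvg (fun k => I k id)
  (fun k => simple_moment_adj _ _ (mg k))
  (fun sigma => let: ex_intro2 m _ cm := cid sigma in cvgP _ cm).
have [S hS cS] := @herm_mx_cvg (fun k => I k (fun y => (y - 0) ^+ 2))
  (fun k => simple_moment_adj _ _ (mg k))
  (fun sigma => let: ex_intro2 m _ cm := csq 0 sigma in cvgP _ cm).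
(* The moment of the constant 1 is 1 in every state, so its form at [w] is the squared norm of
   [w]. *)
have q1 k (w : 'cV[R[i]]_n) : Retr (w *m adjmx w *m I k (fun=> 1)) = Retr (w *m adjmx w).
  have [->|/pure_state[sigma [c ->]]] := eqVneq w 0; first by rewrite !mul0mx.
  rewrite -scalemxAl !RetrZ I1; congr (_ * _).
  by rewrite /Retr state_tr.
exists T, S; split=> //.
- apply: psdmx_Retr => [|u]; first by rewrite adjmxD adjmxN adjmxM hT hS.
  rewrite mulmxBr RetrD RetrN.
  (* With this choice the form in [simple_moment_psd] tends to [u^* S u - u^* T^2 u]. *)
  pose w := T *m u.
  have uwT : Retr (u *m adjmx w *m T) = Retr (u *m adjmx u *m (T *m T)).
    by rewrite adjmxM hT !mulmxA.
  have wwE : Retr (w *m adjmx w) = Retr (u *m adjmx u *m (T *m T)).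
    by rewrite adjmxM hT /w -mulmxA RetrC !mulmxA.
  have lim : (fun k => Retr (u *m adjmx u *m I k (fun y => (y - 0) ^+ 2))
     - 2 * Retr (u *m adjmx w *m I k id)
     + Retr (w *m adjmx w *m I k (fun=> 1))) @ \oo -->
     Retr (u *m adjmx u *m S) - 2 * Retr (u *m adjmx w *m T)
       + Retr (w *m adjmx w).
    apply: cvgD; last by under eq_fun do rewrite q1; exact: cvg_cst.
    by apply: cvgB; [exact: cS|apply: cvgMl_tmp; exact: cT].
  have : 0 <= Retr (u *m adjmx u *m S) - 2 * Retr (u *m adjmx w *m T)
       + Retr (w *m adjmx w).
    rewrite -(cvg_lim (@Rhausdorff R) lim); apply: limr_ge.
      exact: cvgP lim.
    apply: nearW => k.
    have := @simple_moment_psd (s k) (g k) u w (mg k).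
    by rewrite (_ : (fun y => y ^+ 2) = (fun y => (y - 0) ^+ 2))//;
       apply/funext => y; rewrite subr0.
  by rewrite uwT wwE; move: (Retr _) (Retr _) => a b; lra.
- move=> sigma; have [m -> cm] := cid sigma; congr EFin.
  exact: (cvg_unique (@Rhausdorff R) cm (cT _)).
- move=> sigma a; have [m -> cm] := csq a sigma; congr EFin.
  apply: (cvg_unique (@Rhausdorff R) cm).
  rewrite mulmxDr mulmxBr -!scalemxAr !(RetrD, RetrN, RetrZ) mulmx1.
  rewrite /Retr state_tr -!/(Retr _).
  have IE k : I k (fun y => (y - a) ^+ 2) = I k (fun y => (y - 0) ^+ 2)
      - toC (2 * a) *: I k id + toC (a ^+ 2) *: I k (fun=> 1).
    rewrite /I /simple_moment !scaler_sumr -sumrN -!big_split/=.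
    apply: eq_bigr => y _; rewrite !scalerA -!toCM -scaleNr -!scalerDl.
    congr (_ *: _); rewrite -toCB -toCD; congr toC; ring.
  have -> : (fun k => Retr (sigma *m I k (fun y => (y - a) ^+ 2))) = (fun k =>
      Retr (sigma *m I k (fun y => (y - 0) ^+ 2)) - 2 * a * Retr (sigma *m I k id)
      + a ^+ 2 * 1).
    apply/funext => k; rewrite IE mulmxDr mulmxBr -!scalemxAr.
    by rewrite !(RetrD, RetrN, RetrZ) I1.
  apply: cvgD; last exact: cvg_cst.
  by apply: cvgB; [exact: cS|apply: cvgMl_tmp; exact: cT].
Qed.

End second_moment.
End operator_valued_moments.

(** * Vanishing variance on eigenvectors of the first moment operator *)

Section projective_measurement.
Context (R : realType) (n : nat) d (X : measurableType d).
Variable M : measurement R n X.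

Lemma meas_compl_psd (A : set X) : measurable A -> psdmx (1%:M - M A).
Proof.
move=> mA; have hA := psdmx_adj (meas_psd M mA).
apply: psdmx_Retr => [|u]; first by rewrite adjmxD adjmxN adjmx1 hA.
have [->|/pure_state[sigma [c uE]]] := eqVneq u 0.
  by rewrite !mul0mx /Retr mxtrace0.
have uu : 0 <= Retr (u *m adjmx u).
  rewrite -[u *m adjmx u]mulmx1; apply: Retr_psd_ge0; last exact: psdmx1.
  by have := psdmx_gram (adjmx u); rewrite adjmxK.
move: uu; rewrite uE RetrZ /Retr state_tr mulr1 => c0.
rewrite -/(Retr _) -scalemxAl RetrZ mulr_ge0// mulmxBr mulmx1 RetrD RetrN.
rewrite {1}/Retr state_tr subr_ge0 -lee_fin -lawE//.
exact: probability_le1.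
Qed.

Section spectral_measure.
Variables (t : {mfun X >-> R}) (T : 'M[R[i]]_n).
(** This is the moment formula in the efficient case [S = T^2]. *)
Hypothesis mom : forall (sigma : state R n) a,
  (\int[law sigma M]_x ((t x - a) ^+ 2)%:E)%E =
  (Retr (sigma *m (T *m T - toC (2 * a) *: T + toC (a ^+ 2) *: 1%:M)))%:E.

(** In the state of [u] the second moment of [t] around [a] is the form of [(T - a)^2], which is 0.
    So [t = a] almost surely and [A] is null; by [psdmx_form0] its operator annihilates [u]. *)
Lemma eigenvector_neq0 (u : 'cV[R[i]]_n) a (A : set X) :
  T *m u = toC a *: u -> measurable A -> (forall x, A x -> t x != a) ->
  M A *m u = 0.
Proof.
move=> Tu mA At; have [->|/pure_state[sigma [c uE]]] := eqVneq u 0.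
  by rewrite mulmx0.
apply: psdmx_form0; first exact: meas_psd.
have [c0|c0] := eqVneq c 0; first by rewrite uE c0 -scalemxAl RetrZ mul0r.
have int0 : (\int[law sigma M]_x ((t x - a) ^+ 2)%:E)%E = 0%E.
  rewrite mom; congr EFin; apply: (mulfI c0); rewrite mulr0 -RetrZ scalemxAl -uE.
  rewrite -mulmxA RetrC -mulmxA.
  have -> : (T *m T - toC (2 * a) *: T + toC (a ^+ 2) *: 1%:M) *m u = 0.
    rewrite mulmxDl mulmxBl -mulmxA Tu -!scalemxAr -scalemxAl mul1mx Tu.
    rewrite -scalemxAl Tu !scalerA -!toCM -scalerBl -scalerDl -toCB -toCD.
    by rewrite (_ : _ + _ = 0) ?scale0r//; ring.
  by rewrite mulmx0 /Retr mxtrace0.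
have lA : law sigma M A = 0%E.
  have msq : measurable_fun [set: X] (fun x => ((t x - a) ^+ 2)%:E).
    apply/measurable_EFinP; apply: measurable_funX.
    by apply: measurable_funB.
  have /(ae_eq_integral_abs _ measurableT msq) ae0 :
      (\int[law sigma M]_x `|((t x - a) ^+ 2)%:E|)%E = 0%E.
    rewrite -int0; apply: eq_integral => x _.
    by rewrite gee0_abs// lee_fin sqr_ge0.
  (* The integrand is nonzero on [A], so [A] lies in the exceptional null set. *)
  apply: (measure_negligible mA); apply: negligibleS ae0 => x Ax /= /(_ Logic.I).
  move=> [] /eqP; rewrite sqrf_eq0 subr_eq0.
  exact/negP/At.
by move: lA; rewrite lawE// => -[sA]; rewrite uE -scalemxAl RetrZ sA mulr0.
Qed.

(** The operator of the complement of [A] annihilates [u], so the positive semidefinite [1 - M A]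
    has vanishing form at [u]. *)
Lemma eigenvector_id (u : 'cV[R[i]]_n) a (A : set X) :
  T *m u = toC a *: u -> measurable A -> (forall x, ~ A x -> t x != a) ->
  M A *m u = u.
Proof.
move=> Tu mA At; apply/esym/eqP; rewrite -subr_eq0 -{1}[u]mul1mx -mulmxBl.
apply/eqP/psdmx_form0; first exact: meas_compl_psd.
have [->|/pure_state[sigma [c uE]]] := eqVneq u 0.
  by rewrite !mul0mx /Retr mxtrace0.
have mAC : measurable (~` A) by exact: measurableC.
have MC : M (~` A) *m u = 0 by exact: (eigenvector_neq0 Tu).
have : c * Retr (sigma *m M (~` A)) = 0.
  by rewrite -RetrZ scalemxAl -uE -mulmxA RetrC -mulmxA MC mulmx0 /Retr mxtrace0.
rewrite uE -scalemxAl RetrZ mulmxBr mulmx1 RetrD RetrN {2}/Retr state_tr /=.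
suff -> : Retr (sigma *m M (~` A)) = 1 - Retr (sigma *m M A) by [].
by apply: EFin_inj; rewrite EFinB -!lawE// -probability_setC.
Qed.

End spectral_measure.

End projective_measurement.

(** * Simple measurements in an orthonormal eigenbasis *)

Section spectral_projections.
Context (R : realType) (n : nat).
Variables (P T : 'M[R[i]]_n) (d : 'I_n -> R).
Hypotheses (PaP : P *m adjmx P = 1%:M) (aPP : adjmx P *m P = 1%:M).
Hypothesis TE : T = adjmx P *m rdiag d *m P.

Lemma row_eigenvector i : row i P *m T = toC (d i) *: row i P.
Proof.
rewrite -row_mul TE !mulmxA PaP mul1mx.
by apply/rowP => j; rewrite mxE /rdiag mul_diag_mx !mxE.
Qed.

Lemma col_eigenvector i :
  T *m adjmx (row i P) = toC (d i) *: adjmx (row i P).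
Proof.
have hT : adjmx T = T by rewrite TE !adjmxM adjmxK adj_rdiag mulmxA.
by rewrite -{1}hT -adjmxM row_eigenvector adjmxZ.
Qed.

(** An eigenvector for a number other than all [d i] would be orthogonal to every row of [P], hence
    zero. *)
Lemma eigenvalue_spectral a : eigenvalue T (toC a) <-> exists i, d i = a.
Proof.
split=> [/eigenvalueP[v vT v0]|[i <-]]; last first.
  apply/eigenvalueP; exists (row i P); first exact: row_eigenvector.
  apply/eqP => r0; have := congr1 (row i) PaP.
  rewrite row_mul r0 mul0mx => /rowP/(_ i); rewrite !mxE eqxx.
  by move/esym/eqP; rewrite oner_eq0.
apply: contrapT => da; move/eqP : v0; apply.
rewrite -[v]mulmx1 -aPP mulmxA (_ : v *m adjmx P = 0) ?mul0mx//.
apply/rowP => i; rewrite [RHS]mxE.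
have -> : (v *m adjmx P) 0 i = (v *m adjmx (row i P)) 0 0.
  by rewrite !mxE; apply: eq_bigr => k _; rewrite !adjmxE !mxE.
have : toC (a - d i) *: (v *m adjmx (row i P)) = 0.
  by rewrite toCB scalerBl scalemxAl -vT scalemxAr -col_eigenvector mulmxA subrr.
move/eqP; rewrite scaler_eq0 => /orP[|/eqP->]; last by rewrite mxE.
rewrite -[toC _ == 0]/(_ == toC 0) (inj_eq (@complexI R)) subr_eq0 => /eqP ad.
by exfalso; apply: da; exists i.
Qed.

(** The projection onto an eigenspace fixes the rows of [P] in it and kills those in the other,
    orthogonal ones, so at most the term [a = d i] survives. The rows being a basis, this determines
    the measurement. *)
Lemma row_simple_measurement i (B : set R) :
  row i P *m simple_measurement T B = (if `[< B (d i) >] then row i P else 0).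
Proof.
have fA : finite_set [set a : R | B a /\ eigenvalue T a%:C].
  apply: (@sub_finite_set _ _ (range d)); last exact: finite_image.
  by move=> a [_ /eigenvalue_spectral[j <-]]; exists j.
have pE a : row i P *m proj_ortho (eigenspace T a%:C) =
    if a == d i then row i P else 0.
  case: eqVneq => [->|ad].
    by apply: proj_ortho_id; apply/eigenspaceP; exact: row_eigenvector.
  apply: proj_ortho_0; rewrite -/(orthomx _ _ _ _).
  apply/orthomx1P; set E := eigenspace _ _.
  have ET : E *m T = toC a *: E by apply/eigenspaceP.
  have hT : adjmx T = T by rewrite TE !adjmxM adjmxK adj_rdiag mulmxA.
  have : toC (d i - a) *: (row i P *m adjmx E) = 0.
    rewrite toCB scalerBl scalemxAl -row_eigenvector.
    by rewrite -[in X in X - _]hT -mulmxA -adjmxM ET adjmxZ -scalemxAr subrr.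
  move/eqP; rewrite scaler_eq0 => /orP[|/eqP//].
  rewrite -[toC _ == 0]/(_ == toC 0) (inj_eq (@complexI R)) subr_eq0.
  by rewrite eq_sym (negbTE ad).
rewrite /simple_measurement fsbig_finite//= mulmx_sumr.
under eq_bigr do rewrite pE.
case: asboolP => Bd.
  rewrite (bigD1_seq (d i)) ?finmap.fset_uniq//=; last first.
    rewrite in_fset_set// inE; split => //.
    by apply/eigenvalue_spectral; exists i.
  by rewrite eqxx big1 ?addr0// => a /negbTE ->.
rewrite big_seq big1// => a; rewrite in_fset_set// inE => -[Ba _].
by case: eqVneq => // ad; rewrite ad in Ba.
Qed.

End spectral_projections.

(** * Differentiation rules and scalar linear equations on an interval *)

Section real_derivatives.
Context (R : realType).
Implicit Types (f g : R -> R) (x a b : R).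

Lemma is_derive_mulf f g x a b : is_derive x 1 f a -> is_derive x 1 g b ->
  is_derive x 1 (fun s => f s * g s) (a * g x + f x * b).
Proof.
move=> hf hg; apply: (@is_derive_eq _ _ _ _ _ _ _ _ (is_deriveM hf hg)).
by rewrite /GRing.scale/= addrC mulrC.
Qed.

Lemma is_derive_addf f g x a b : is_derive x 1 f a -> is_derive x 1 g b ->
  is_derive x 1 (fun s => f s + g s) (a + b).
Proof. by move=> hf hg; exact: is_deriveD. Qed.

Lemma is_derive_scalef f k x a : is_derive x 1 f a ->
  is_derive x 1 (fun s => k * f s) (k * a).
Proof. by move=> hf; exact: is_deriveZ. Qed.

Lemma is_derive_sumf (I : Type) (r : seq I) (F : I -> R -> R) (D : I -> R) x :
  (forall i, is_derive x 1 (F i) (D i)) ->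
  is_derive x 1 (fun s => \sum_(i <- r) F i s) (\sum_(i <- r) D i).
Proof.
move=> hF; elim: r => [|i r IH].
  rewrite big_nil; under eq_fun do rewrite big_nil; exact: is_derive_cst.
rewrite big_cons; under eq_fun do rewrite big_cons.
exact: is_derive_addf.
Qed.

Lemma is_derive_expf f x a : is_derive x 1 f a ->
  is_derive x 1 (fun s => expR (f s)) (a * expR (f x)).
Proof.
by move=> hf; rewrite mulrC; exact: (is_derive1_comp (is_derive_expR _) hf).
Qed.

Lemma is_derive_lnf f x a : 0 < f x -> is_derive x 1 f (a * f x) ->
  is_derive x 1 (fun s => ln (f s)) a.
Proof.
move=> f0 hf; apply: (@is_derive_eq _ _ _ _ _ _ _ _
  (is_derive1_comp (is_derive1_ln f0) hf)).
by rewrite mulrC mulfK// gt_eqF.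
Qed.

Lemma derive0_interval_cst (D : set R) f : is_interval D ->
  (forall x, D x -> is_derive x 1 f 0) ->
  forall x y, D x -> D y -> f x = f y.
Proof.
move=> iD df.
have lt_eq x y : D x -> D y -> x < y -> f x = f y.
  move=> Dx Dy xy.
  have Dz z : z \in `[x, y] -> D z.
    by rewrite in_itv/=; exact: iD.
  have [z||z _] := @MVT R f (fun=> 0) x y xy.
  - move=> zxy; apply/df/Dz; exact: subset_itv_oo_cc zxy.
  - apply: derivable_within_continuous => z zxy.
    exact: (@ex_derive _ _ _ _ _ _ _ (df _ (Dz _ zxy))).
  by rewrite mul0r => /eqP; rewrite subr_eq0 => /eqP.
move=> x y Dx Dy; have [xy|yx|->//] := ltgtP x y; first exact: lt_eq.
by apply/esym/lt_eq.
Qed.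

(** The product of [f] and [expR (- w)] has derivative 0 and is therefore constant. *)
Lemma linear_ode_interval (D : set R) f (w w' : R -> R) : is_interval D ->
  (forall x, D x -> is_derive x 1 w (w' x)) ->
  (forall x, D x -> is_derive x 1 f (w' x * f x)) ->
  forall x y, D x -> D y -> f x = expR (w x) * (expR (- w y) * f y).
Proof.
move=> iD hw hf x y Dx Dy.
have cst z : D z -> is_derive z 1 (fun s => f s * expR (-1 * w s)) 0.
  move=> Dz; apply: (@is_derive_eq _ _ _ _ _ _ _ _ (is_derive_mulf (hf _ Dz)
    (is_derive_expf (is_derive_scalef (-1) (hw _ Dz))))).
  by ring.
have := derive0_interval_cst iD cst Dx Dy; rewrite !mulN1r => fxy.
by rewrite [expR (- w y) * _]mulrC -fxy mulrCA -expRD subrr expR0 mulr1.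
Qed.

End real_derivatives.

(** * Derivatives of matrix entries and the exponential of a Hermitian matrix *)

Section matrix_derivatives.
Context (R : realType) (n : nat).
Implicit Types (F : R -> 'M[R[i]]_n).

Lemma is_derive_Retr F x (A : 'M[R[i]]_n) : derivable_mx F x ->
  is_derive x 1 (fun s => Retr (A *m F s)) (Retr (A *m Defs.derive_mx F x)).
Proof.
move=> dF; rewrite RetrE; under eq_fun do rewrite RetrE.
apply: is_derive_sumf => i; apply: is_derive_sumf => j.
have [/derivableP hr /derivableP hi] := dF j i.
rewrite !mxE /= !derive1E -mulNr.
under eq_fun do rewrite -mulNr.
by apply: is_derive_addf; exact: is_derive_scalef.
Qed.


Lemma mxentry_tr (A : 'M[R[i]]_n) i j : A i j = \tr (delta_mx j i *m A).
Proof.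
rewrite -(mul_delta_mx (0 : 'I_1)) -mulmxA mxtrace_mulC -mulmxA -colE -rowE.
by rewrite trace_mx11 !mxE.
Qed.

(** Each entry of [P F Q] is the trace of [F] against a fixed matrix; multiplying that matrix by
    [-i] turns the imaginary part into a real one. *)
Lemma is_derive_congr_entry F x (P Q : 'M[R[i]]_n) i j : derivable_mx F x ->
  is_derive x 1 (fun s => complex.Re ((P *m F s *m Q) i j))
    (complex.Re ((P *m Defs.derive_mx F x *m Q) i j)) /\
  is_derive x 1 (fun s => complex.Im ((P *m F s *m Q) i j))
    (complex.Im ((P *m Defs.derive_mx F x *m Q) i j)).
Proof.
move=> dF.
pose A : 'M[R[i]]_n := Q *m delta_mx j i *m P.
have trE G : (P *m G *m Q) i j = \tr (A *m G).
  by rewrite mxentry_tr !mulmxA mxtrace_mulC !mulmxA.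
have ReE G : complex.Re ((P *m G *m Q) i j) = Retr (A *m G) by rewrite trE.
have ImE G : complex.Im ((P *m G *m Q) i j) =
    Retr ((((0 -i* 1)%C : R[i]) *: A) *m G).
  rewrite trE -scalemxAl /Retr linearZ /=.
  by case: (\tr _) => a b /=; rewrite mul0r sub0r mulN1r opprK.
split; [rewrite ReE|rewrite ImE].
  by under eq_fun do rewrite ReE; exact: is_derive_Retr.
by under eq_fun do rewrite ImE; exact: is_derive_Retr.
Qed.

Lemma rdiagM (d e : 'I_n -> R) :
  rdiag d *m rdiag e = rdiag (fun i => d i * e i) :> 'M[R[i]]_n.
Proof.
apply/matrixP => i j; rewrite /rdiag mul_diag_mx !mxE.
by have [->|ij] := eqVneq i j; rewrite ?mulr1n ?toCM// !mulr0n mulr0.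
Qed.

Section spectral_calculus.
Variables (P T : 'M[R[i]]_n) (d : 'I_n -> R).
Hypotheses (PaP : P *m adjmx P = 1%:M) (aPP : adjmx P *m P = 1%:M).
Hypothesis TE : T = adjmx P *m rdiag d *m P.

Lemma spectral_pow x k :
  (toC x *: T) ^+ k = adjmx P *m rdiag (fun i => (x * d i) ^+ k) *m P.
Proof.
elim: k => [|k IH].
  have -> : rdiag (fun i => (x * d i) ^+ 0) = 1%:M :> 'M[R[i]]_n.
    by rewrite (_ : (fun i => _) = fun=> 1) ?rdiag_cst.
  by rewrite mulmx1 aPP expr0.
have -> : rdiag (fun i => (x * d i) ^+ k.+1) =
    (toC x *: rdiag d) *m rdiag (fun i => (x * d i) ^+ k) :> 'M[R[i]]_n.
  rewrite -scalemxAl rdiagM; apply/matrixP => i j; rewrite !mxE exprS -mulrA.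
  by rewrite toCM mulrnAr.
rewrite exprS IH TE -[LHS]/(_ *m _) scalemxAl scalemxAr !mulmxA.
by rewrite -(mulmxA _ P) PaP mulmx1.
Qed.

(** In the eigenbasis the partial sums are diagonal with scalar exponential series as entries, so
    each matrix entry is a finite combination of convergent series. *)
Lemma expm_spectral x :
  expm (toC x *: T) = adjmx P *m rdiag (fun i => expR (x * d i)) *m P.
Proof.
have sE k : \sum_(0 <= m < k) (m`!%:R^-1 : R[i]) *: (toC x *: T) ^+ m =
    adjmx P *m rdiag (fun i => series (exp_coeff (x * d i)) k) *m P.
  under eq_bigr => m _ do rewrite spectral_pow scalemxAl scalemxAr.
  rewrite -mulmx_suml -mulmx_sumr; congr (_ *m _ *m _).
  apply/matrixP => i j; rewrite summxE !mxE /series/= toC_sum -sumrMnl.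
  apply: eq_bigr => m _; rewrite !mxE mulrnAr; congr (_ *+ _).
  by rewrite /exp_coeff/= mulrC toCM; congr (_ * _); rewrite /toC rmorphV ?unitfE
    ?pnatr_eq0 -?lt0n ?fact_gt0// rmorph_nat.
have entryE e i j : (adjmx P *m rdiag e *m P) i j =
    \sum_l toC (e l) * (adjmx P i l * P l j).
  rewrite mxE; apply: eq_bigr => l _.
  by rewrite /rdiag mul_mx_diag !mxE mulrA; congr (_ * _); rewrite mulrC.
have cv l : (fun k => series (exp_coeff (x * d l)) k) @ \oo --> expR (x * d l).
  exact: is_cvg_series_exp_coeff.
apply/matrixP => i j; rewrite mxE entryE.
have ReM a (z : R[i]) : complex.Re (toC a * z) = a * complex.Re z.
  by case: z => b c /=; rewrite mul0r subr0.
have ImM a (z : R[i]) : complex.Im (toC a * z) = a * complex.Im z.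
  by case: z => b c /=; rewrite mul0r addr0.
have ReS (F : 'I_n -> R[i]) : complex.Re (\sum_l F l) = \sum_l complex.Re (F l).
  exact: raddf_sum.
have ImS (F : 'I_n -> R[i]) : complex.Im (\sum_l F l) = \sum_l complex.Im (F l).
  exact: raddf_sum.
apply/eqP; rewrite eq_complex; apply/andP; split; apply/eqP => /=.
  rewrite ReS; apply: (cvg_lim (@Rhausdorff R)).
  under eq_fun do rewrite sE entryE ReS.
  apply: cvg_big => [|l _]; first exact: add_continuous.
  rewrite ReM; under eq_fun do rewrite ReM.
  by apply: cvgMr_tmp; exact: cv.
rewrite ImS; apply: (cvg_lim (@Rhausdorff R)).
under eq_fun do rewrite sE entryE ImS.
apply: cvg_big => [|l _]; first exact: add_continuous.
rewrite ImM; under eq_fun do rewrite ImM.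
by apply: cvgMr_tmp; exact: cv.
Qed.

End spectral_calculus.

End matrix_derivatives.

(** * Integration of the score equation *)

Section exponential_family.
Context (R : realType) (n : nat).

(** Conjugation by [P] decouples the equation. Up to a common term, the exponent for entry [(k, l)]
    is a part depending on [k] plus one depending on [l]; these become the left and right
    exponential factors. *)
Lemma score_exponential_family (Theta : set R) (rho : R -> 'M[R[i]]_n)
    (T : 'M[R[i]]_n) (J : R -> R) (theta0 : R) :
  is_interval Theta -> Theta theta0 -> adjmx T = T ->
  (forall theta, Theta theta -> derivable_mx rho theta) ->
  (forall theta, Theta theta -> posdefmx (rho theta)) ->
  (forall theta, Theta theta -> Defs.derive_mx rho theta = toC (J theta / 2) *:
    (rho theta *m (T - (toC theta)%:M) + (T - (toC theta)%:M) *m rho theta)) ->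
  (forall x : R, T <> (toC x)%:M) ->
  exists (rho0 : 'M[R[i]]_n) (c gamma : R -> R),
    [/\ psdmx rho0,
        forall theta, Theta theta -> is_derive theta 1 gamma (J theta) &
        forall theta, Theta theta -> 0 < c theta /\
          rho theta = toC (c theta) *:
            (expm (toC (gamma theta / 2) *: T) *m rho0 *m
             expm (toC (gamma theta / 2) *: T))].
Proof.
move=> iTheta Theta0 /hermsymP/herm_spectral[P [d [PaP aPP TE]]] drho prho ode nsc.
pose r s := P *m rho s *m adjmx P.
have rK s : rho s = adjmx P *m r s *m P.
  by rewrite /r !mulmxA aPP mul1mx -mulmxA aPP mulmx1.
(* Multiplication by [T - s] from the two sides gives [d k - s] and [d l - s], and the factor
   [J / 2] leaves their mean. *)
pose w' k l s := J s * ((d k + d l) / 2 - s).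
have dr k l theta : Theta theta ->
    is_derive theta 1 (fun s => complex.Re (r s k l))
      (w' k l theta * complex.Re (r theta k l)) /\
    is_derive theta 1 (fun s => complex.Im (r s k l))
      (w' k l theta * complex.Im (r theta k l)).
  move=> Th.
  have rE : (P *m Defs.derive_mx rho theta *m adjmx P) k l =
      toC (w' k l theta) * r theta k l.
    have PBP : P *m (T - (toC theta)%:M) *m adjmx P =
        rdiag (fun i => d i - theta).
      rewrite rdiagB rdiag_cst mulmxBr mulmxBl TE !mulmxA PaP mul1mx.
      by rewrite -mulmxA PaP mulmx1 scalar_mxC -mulmxA PaP mulmx1.
    have -> : P *m Defs.derive_mx rho theta *m adjmx P = toC (J theta / 2) *:
        (r theta *m rdiag (fun i => d i - theta) +
         rdiag (fun i => d i - theta) *m r theta).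
      rewrite -PBP ode// -scalemxAr -scalemxAl mulmxDr mulmxDl; congr (_ *: (_ + _)).
        by rewrite /r -!mulmxA (mulmxA (adjmx P) P) aPP mul1mx.
      by rewrite /r -!mulmxA (mulmxA (adjmx P) P) aPP mul1mx.
    rewrite mxE [in X in _ * X]mxE mul_mx_rdiag mul_rdiag_mx.
    rewrite [r theta k l * _]mulrC -mulrDl mulrA -toCD -toCM.
    by congr (toC _ * _); rewrite /w'; field.
  have [dRe dIm] := is_derive_congr_entry P (adjmx P) k l (drho _ Th).
  rewrite rE in dRe dIm; split.
    apply: (is_derive_eq dRe).
    by case: (r theta k l) => a b; rewrite /= mul0r subr0.
  apply: (is_derive_eq dIm).
  by case: (r theta k l) => a b; rewrite /= mul0r addr0.
have rpos k s : Theta s -> 0 < complex.Re (r s k k).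
  move=> Ts; have /posdefmxP[_ pos] := prho _ Ts.
  have u0 : adjmx (row k P) != 0.
    apply/eqP => u0; have := adj_spectral_row PaP k; rewrite u0 mulmx0.
    move=> /matrixP/(_ 0 0); rewrite !mxE eqxx => /esym/eqP.
    by rewrite oner_eq0.
  have := pos _ u0; rewrite adjmxK -row_mul ltcE => /andP[_].
  rewrite (_ : (_ *m _) 0 0 = r s k k)//.
  by rewrite /r !mxE; apply: eq_bigr => l _; rewrite !adjmxE !mxE.
have [i [j ij]] : exists i j, d i != d j.
  apply: contrapT => dd; have [x dx] : exists x, forall k, d k = x.
    case: (pickP 'I_n) => [k0 _|n0]; last by exists 0 => k; have := n0 k.
    exists (d k0) => k; apply/eqP; apply: contrapT => kk.
    by apply: dd; exists k, k0; exact/negP.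
  apply: (nsc x); rewrite TE (_ : d = fun=> x); last exact/funext.
  by rewrite rdiag_cst scalar_mxC -mulmxA aPP mulmx1.
pose u k s := ln (complex.Re (r s k k)).
have du k theta : Theta theta -> is_derive theta 1 (u k) (J theta * (d k - theta)).
  move=> Th; apply: is_derive_lnf; first exact: rpos.
  have [dRe _] := dr k k _ Th; move: dRe; rewrite /w'.
  by rewrite (_ : (d k + d k) / 2 = d k)//; field.
(* Since [u k] has derivative [J (d k - theta)], the [theta] cancels in the difference and
   [J (d i - d j)] remains. *)
pose gamma s := (d i - d j)^-1 * (u i s + -1 * u j s).
(* A primitive of [- theta J], which becomes the logarithm of the normalising constant. *)
pose lc s := u i s + - d i * gamma s.
have dgamma theta : Theta theta -> is_derive theta 1 gamma (J theta).
  move=> Th; apply: (@is_derive_eq _ _ _ _ _ _ _ _ (is_derive_scalef _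
    (is_derive_addf (du i _ Th) (is_derive_scalef _ (du j _ Th))))).
  by field; rewrite subr_eq0.
have dlc theta : Theta theta -> is_derive theta 1 lc (- theta * J theta).
  move=> Th; apply: (@is_derive_eq _ _ _ _ _ _ _ _
    (is_derive_addf (du i _ Th) (is_derive_scalef _ (dgamma _ Th)))).
  by ring.
pose w k l s := (d k + d l) / 2 * gamma s + lc s.
have dw k l theta : Theta theta -> is_derive theta 1 (w k l) (w' k l theta).
  move=> Th; apply: (@is_derive_eq _ _ _ _ _ _ _ _
    (is_derive_addf (is_derive_scalef _ (dgamma _ Th)) (dlc _ Th))).
  by rewrite /w'; ring.
have rsol k l theta : Theta theta ->
    r theta k l = toC (expR (w k l theta) * expR (- w k l theta0)) * r theta0 k l.
  move=> Th; apply/eqP; rewrite eq_complex; apply/andP; split; apply/eqP.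
    rewrite (linear_ode_interval iTheta (dw k l) (fun s Ts => (dr k l s Ts).1) Th Theta0).
    by rewrite mulrA; case: (r theta0 k l) => a b /=; rewrite mul0r subr0.
  rewrite (linear_ode_interval iTheta (dw k l) (fun s Ts => (dr k l s Ts).2) Th Theta0).
  by rewrite mulrA; case: (r theta0 k l) => a b /=; rewrite mul0r addr0.
pose e s := rdiag (fun k => expR (s * d k)) : 'M[R[i]]_n.
pose g0 := gamma theta0 / 2.
(* The state at [theta0], stripped of its own normalising and exponential factors. *)
exists (adjmx P *m (toC (expR (- lc theta0)) *: (e (- g0) *m r theta0 *m e (- g0))) *m P).
exists (expR \o lc), gamma; split => // [|theta Th].
  apply: psdmx_congr; apply: psdmxZ; first exact: expR_ge0.
  rewrite -[X in X *m _ *m _]adj_rdiag; apply: psdmx_congr.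
  have := psdmx_congr (adjmx P) (posdef_psd (prho _ Theta0)).
  by rewrite adjmxK.
split; first exact: expR_gt0.
rewrite !(expm_spectral PaP aPP TE) -/(e (gamma theta / 2)) {1}rK.
have sandwich A B C : adjmx P *m A *m P *m (adjmx P *m B *m P) *m
    (adjmx P *m C *m P) = adjmx P *m (A *m B *m C) *m P.
  have PK (Z : 'M[R[i]]_n) : P *m (adjmx P *m Z) = Z by rewrite mulmxA PaP mul1mx.
  by rewrite -!mulmxA !PK.
rewrite sandwich scalemxAl scalemxAr; congr (_ *m _ *m _).
apply/matrixP => k l; rewrite [RHS]mxE mul_mx_rdiag mul_rdiag_mx.
rewrite [X in _ * (_ * X * _)]mxE mul_mx_rdiag mul_rdiag_mx rsol//.
have -> : w k l theta = lc theta + gamma theta / 2 * d k + gamma theta / 2 * d l.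
  by rewrite /w; field.
have -> : - w k l theta0 = - lc theta0 + - g0 * d k + - g0 * d l.
  by rewrite /w /g0; field.
by move=> /=; move: (lc theta) (lc theta0) => a b; rewrite !expRD !toCM; ring.
Qed.

End exponential_family.

(** * Equality in Helstrom's bound *)

Section efficient_estimator.
Context (R : realType) (n : nat).

(** The identity holds on a neighbourhood of [theta] and can be differentiated there. *)
Lemma derive_unbiased (Theta : set R) (rho : R -> 'M[R[i]]_n) (T : 'M[R[i]]_n)
    (f : R -> R) (a theta : R) :
  open Theta -> Theta theta -> derivable_mx rho theta ->
  (forall s, Theta s -> Retr (T *m rho s) = f s) -> is_derive theta 1 f a ->
  Retr (T *m Defs.derive_mx rho theta) = a.
Proof.
move=> oT Th drho Tf df; have dT := is_derive_Retr T drho.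
have : is_derive theta 1 (fun s => Retr (T *m rho s)) a.
  apply: near_eq_is_derive df; near=> s; apply/esym/Tf; near: s.
  exact: open_nbhs_nbhs.
by move=> da; rewrite -(@derive_val _ _ _ _ _ _ _ dT) (@derive_val _ _ _ _ _ _ _ da).
Unshelve. all: by end_near. Qed.

(** The variance is the nonnegative excess [Re tr (rho (S - T^2))] plus the squared norm of
    [B = T - theta]. That norm alone is at least [1 / I], as [B] has inner product 1 with the score;
    so the excess vanishes and [B = L / I]. *)
Lemma efficient_score (rho : R -> state R n) (theta : R) (T S : 'M[R[i]]_n) :
  adjmx T = T -> psdmx (S - T *m T) -> posdefmx (rho theta) ->
  Retr (Defs.derive_mx rho theta *m T) = 1 ->
  Retr (Defs.derive_mx rho theta) = 0 ->
  Retr (rho theta *m (S - toC (2 * theta) *: T + toC (theta ^+ 2) *: 1%:M)) =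
    (qinfo rho theta)^-1 ->
  S = T *m T /\
  Defs.derive_mx rho theta = toC (qinfo rho theta / 2) *:
    (rho theta *m (T - (toC theta)%:M) + (T - (toC theta)%:M) *m rho theta).
Proof.
move=> hT pS pr dT d1 var.
set I := qinfo rho theta in var *; set r : 'M[R[i]]_n := rho theta in pr var *.
set L := qscore rho theta.
pose B := T - (toC theta)%:M.
have hB : adjmx B = B.
  by rewrite /B adjmxD adjmxN -scalemx1 adjmxZ adjmx1 hT.
have BB : B *m B = T *m T - toC (2 * theta) *: T + toC (theta ^+ 2) *: 1%:M.
  rewrite /B !(mulmxDl, mulmxDr, mulmxN, mulNmx) !(mul_scalar_mx, mul_mx_scalar).
  have -> : 2 * theta = theta + theta by ring.
  rewrite -[in LHS](scalemx1 _ (toC theta)) scalerA -toCM -expr2.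
  by rewrite toCD scalerDl opprD opprK !addrA.
have dB : Retr (Defs.derive_mx rho theta *m B) = 1.
  by rewrite /B -scalemx1 mulmxBr -scalemxAr mulmx1 RetrD RetrN RetrZ dT d1; ring.
have varB : Retr (r *m (S - T *m T)) + Retr (r *m (B *m B)) = I^-1.
  rewrite -var -RetrD -mulmxDr BB; congr (Retr (_ *m _)).
  by rewrite !addrA subrK.
have pST : 0 <= Retr (r *m (S - T *m T)).
  exact: (Retr_psd_ge0 (posdef_psd pr) pS).
have leB : Retr (r *m (B *m B)) <= I^-1 by rewrite -varB lerDr.
have IE : I = Retr (r *m (L *m L)) by [].
(* The second case is the default value of [qscore], refuted below: [I] and its inverse would be 0,
   forcing [B = 0] against [dB]. *)
have [score|L0] : is_qscore rho theta L \/ L = 0.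
  rewrite /L /qscore; case: xgetP => [A _ As|]; [by left|by right].
- have [hL dE] := score; move/hermsymP in hL.
  have dE' : Defs.derive_mx rho theta = toC 2^-1 *: (r *m L + L *m r).
    by rewrite dE; congr (_ *: _); rewrite /toC fmorphV rmorph_nat.
  have hr : adjmx r = r by case/posdefmxP : pr.
  (* Both halves of the symmetrised product have the same real trace against [B]. *)
  have rLB : Retr (r *m (L *m B)) = 1.
    have : Retr (L *m r *m B) = Retr (r *m (L *m B)).
      by rewrite -Retr_adj !adjmxM hr hL hB mulmxA RetrC !mulmxA RetrC !mulmxA.
    move: dB; rewrite dE' -scalemxAl RetrZ mulmxDl RetrD -mulmxA => h1 h2.
    by rewrite h2 in h1; move: h1; move: (Retr _) => x; lra.
  rewrite IE in leB varB *.
  have [BE varE] := score_Cauchy_Schwarz_eq pr hB hL rLB leB.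
  have I0 : Retr (r *m (L *m L)) != 0.
    apply/eqP => I0; move: rLB; rewrite BE I0 invr0 -scalemxAr -scalemxAr RetrZ.
    by rewrite mul0r => /esym/eqP; rewrite oner_eq0.
  split.
    apply/eqP; rewrite -subr_eq0; apply/eqP/(posdef_Retr0 pr pS).
    by move: varB; rewrite varE => /eqP; rewrite addrC -subr_eq0 addrAC subrr add0r => /eqP ->.
  rewrite dE' -/B BE -scalemxAr -scalemxAl -scalerDr scalerA -toCM; congr (toC _ *: _).
  by field.
- have I0 : I = 0 by rewrite IE L0 !mulmx0 /Retr mxtrace0.
  have BB0 : B *m B = 0.
    apply: (posdef_Retr0 pr); last by move: leB; rewrite I0 invr0.
    by rewrite -[X in X *m _]hB; exact: psdmx_gram.
  have B0 : B = 0 by apply: gram_eq0; rewrite hB.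
  move: dB; rewrite B0 mulmx0 /Retr mxtrace0 => /esym/eqP.
  by rewrite oner_eq0.
Qed.

End efficient_estimator.

(** * From an efficient unbiased estimator to the exponential model and the spectral measure *)

Theorem theorem3 (R : realType) (n : nat) (Theta : set R)
    (rho : R -> state R n)
    (d : measure_display) (X : measurableType d)
    (M : measurement R n X) (t : {mfun X >-> R}) :
  open Theta -> is_interval Theta ->
  (forall theta, Theta theta -> derivable_mx rho theta) ->
  (forall theta, Theta theta -> posdefmx (rho theta)) ->
  (exists2 theta, Theta theta & distinct_eigenvalues (qscore rho theta)) ->
  smooth_mx_on Theta (qscore rho) ->
  (forall theta, Theta theta -> ('E_(law (rho theta) M)[t] = theta%:E)%E) ->
  (forall theta, Theta theta ->
     ('V_(law (rho theta) M)[t] = ((qinfo rho theta)^-1)%:E)%E) ->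
  exists (T rho0 : 'M[R[i]]_n) (c gamma : R -> R),
    [/\ T \is hermsymmx, psdmx rho0,
        forall theta, Theta theta ->
          is_derive theta 1 gamma (qinfo rho theta),
        forall theta, Theta theta -> 0 < c theta /\
          rho theta = (c theta)%:C *:
            (expm ((gamma theta / 2)%:C *: T) *m rho0 *m
             expm ((gamma theta / 2)%:C *: T)) :> 'M[R[i]]_n
      & forall B : set R, measurable B ->
          simple_measurement T B = coarsening M t B].
Proof.
move=> oTheta iTheta drho prho [theta0 Theta0 _] _ Et Vt.
(* Unbiasedness makes the variance the second moment around [theta]. *)
have var theta : Theta theta -> (\int[law (rho theta) M]_x
    ((t x - theta) ^+ 2)%:E)%E = ((qinfo rho theta)^-1)%:E.
  move=> Th; rewrite -Vt// /variance covariance.unlock Et//= expectation.unlock.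
  by apply: eq_integral => x _; rewrite expr2.
have mt : measurable_fun [set: X] t by [].
have fin : (\int[law (rho theta0) M]_x ((t x - theta0) ^+ 2)%:E < +oo)%E.
  by rewrite var// ltry.
have [T [S [hT hS pST momT momS]]] := moment_operators mt (prho _ Theta0) fin.
have ET theta : Theta theta -> Retr (rho theta *m T) = theta.
  move=> Th; apply: EFin_inj; rewrite -momT -Et//.
  by rewrite expectation.unlock.
have dT theta : Theta theta -> Retr (Defs.derive_mx rho theta *m T) = 1.
  move=> Th; rewrite RetrC; apply: (derive_unbiased oTheta Th (drho _ Th) (f := id)).
  by move=> s Ts; rewrite RetrC; exact: ET.
have d1 theta : Theta theta -> Retr (Defs.derive_mx rho theta) = 0.
  move=> Th; rewrite -[Defs.derive_mx _ _]mul1mx.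
  apply: (derive_unbiased oTheta Th (drho _ Th) (f := fun=> 1)).
  by move=> s _; rewrite mul1mx /Retr state_tr.
have eff theta (Th : Theta theta) := efficient_score hT pST (prho _ Th)
  (dT _ Th) (d1 _ Th) (EFin_inj (etrans (esym (momS _ _)) (var _ Th))).
(* A scalar [T] would pair to 0 with the derivative, whose trace has real part 0, instead of to
   1. *)
have nsc (x : R) : T <> (toC x)%:M.
  move=> Tx; have := dT _ Theta0.
  rewrite Tx -scalemx1 -scalemxAr mulmx1 RetrZ d1// mulr0 => /esym/eqP.
  by rewrite oner_eq0.
have [rho0 [c [gamma [prho0 dgamma rhoE]]]] := score_exponential_family iTheta
  Theta0 hT drho prho (fun theta Th => (eff theta Th).2) nsc.
(* The exponent runs along [gamma], a primitive of the quantum information. *)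
exists T, rho0, c, gamma; split => //.
- exact/hermsymP.
- have [SE _] := eff _ Theta0; rewrite SE in momS.
  move=> B mB; have [P [e [PaP aPP TE]]] := herm_spectral (introT (hermsymP T) hT).
  have mtB : measurable (t @^-1` B) by exact: measurable_funPTI.
  (* Both measurements are compared on the rows of [P]: each keeps row [i] if its eigenvalue lies in
     [B] and kills it otherwise. *)
  rewrite -[LHS]mul1mx -[RHS]mul1mx -aPP -!mulmxA; congr (_ *m _).
  apply/row_matrixP => i; rewrite !row_mul.
  rewrite (row_simple_measurement PaP aPP TE) /=.
  have Tu := col_eigenvector PaP TE i.
  have hM := psdmx_adj (meas_psd M mtB).
  (* The operators of [M] are known on column eigenvectors; being Hermitian, they act on rows
     through the adjoint. *)
  have -> : row i P *m M (t @^-1` B) = adjmx (M (t @^-1` B) *m adjmx (row i P)).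
    by rewrite adjmxM adjmxK hM.
  case: asboolP => Bi.
    rewrite (eigenvector_id momS Tu mtB) ?adjmxK// => x.
    by apply: contra_notN => /eqP xi; rewrite /= xi.
  rewrite (eigenvector_neq0 momS Tu mtB); first by rewrite /adjmx trmx0 map_mx0.
  by move=> x Bx; apply: contra_notN Bi => /eqP <-.
Qed.
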